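(* Let $D\subseteq\mathbb{R}^N$ be a bounded Lipschitz domain, let $A$ be an $N$-function satisfying the $\Delta_2$ condition, let $s\in(0,1)$, and suppose that $\liminf_{\lambda\to0+}\alpha_{s,A}(\lambda)=0$, where $$\alpha_{s,A}(\lambda):=\sup_{t>0}\frac{A(\lambda t)}{\lambda^{1/s}A(t)}.$$ Then the fractional Orlicz Hardy inequality $FOHI(s,A)$ and the regional fractional Orlicz Poincaré inequality $RFOPI(s,A)$ hold in $D$, that is, $H_{N,s,A}(D)>0$ and $P^1_{N,s,A}(D)>0$.
   Context: An $N$-function is a continuous convex function $A:[0,\infty)\to[0,\infty)$ with $\lim_{t\to0}A(t)/t=0$ and $\lim_{t\to\infty}A(t)/t=\infty$. $A$ satisfies the $\Delta_2$ condition ($A\in\Delta_2$) if there is a constant $p>0$ with $A(2t)\le pA(t)$ for all $t>0$ (this forces $A(t)>0$ for $t>0$). A domain is a nonempty connected open set. A bounded domain $D\subset\mathbb{R}^N$ is Lipschitz if there are constants $r_0>0$ and $\mathrm{Lip}(D)<\infty$ such that for each $z\in\partial D$ there are a linear isometry $L_z:\mathbb{R}^N\to\mathbb{R}^N$ and a Lipschitz function $\phi_z:\mathbb{R}^{N-1}\to\mathbb{R}$ with Lipschitz constant at most $\mathrm{Lip}(D)$ such that $L_z(D)\cap B(L_z(z),r_0)=\{x=(\tilde x,x_N)\in\mathbb{R}^N: x_N>\phi_z(\tilde x)\}\cap B(L_z(z),r_0)$. For an open set $D\subsetneq\mathbb{R}^N$, $\delta_x=\delta_D(x):=\inf\{|x-y|:y\in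 D^c\}$. Define $$M_{W^{s,A}(D)}(f):=\iint_{D\times D}A\left(\frac{|f(x)-f(y)|}{|x-y|^s}\right)\frac{dx\,dy}{|x-y|^N},$$ $$H_{N,s,A}(D):=\inf_{f\in C_c^\infty(D),\,f\ne0}\frac{M_{W^{s,A}(D)}(f)}{\int_D A\left(|f(x)|/\delta_x^s\right)dx},\qquad P^1_{N,s,A}(D):=\inf_{f\in C_c^\infty(D),\,f\neq0}\frac{M_{W^{s,A}(D)}(f)}{\int_D A(|f(x)|)dx}.$$ $FOHI(s,A)$ holds in $D$ if $H_{N,s,A}(D)>0$; $RFOPI(s,A)$ holds in $D$ if $P^1_{N,s,A}(D)>0$. *)

(* Defs.v *)
From HB Require Import structures.
From mathcomp Require Import all_boot all_order all_algebra.
From mathcomp Require Import all_classical all_reals all_analysis.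
Set Implicit Arguments.
Unset Strict Implicit.
Unset Printing Implicit Defensive.
Import Order.TTheory GRing.Theory Num.Theory.
Import numFieldNormedType.Exports.
Local Open Scope classical_set_scope.
Local Open Scope ring_scope.

(* The library's norm on 'rV[R]_n is the sup norm. It induces the Euclidean
   topology, so open, closed, compact, connected and bounded_set below are
   the library's notions, but every distance is Euclidean. *)
Definition enorm (R : realType) (n : nat) (x : 'rV[R]_n) : R :=
  Num.sqrt (\sum_(i < n) x 0 i ^+ 2).

Definition eball (R : realType) (n : nat) (z : 'rV[R]_n) (r : R) :
  set 'rV[R]_n := [set x | enorm (x - z) < r].

(* The sigma-algebra on 'rV[R]_n is the one generated by the coordinates,
   as the library does for n.-tuple R. It is the Borel sigma-algebra
   (see open_measurable_rV). *)
Definition measure_rV_display : measure_display -> measure_display.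
Proof. exact. Qed.

Section measurable_rV.
Context {R : realType}.
Variable n : nat.

Let coor : 'I_n -> 'rV[R]_n -> measurableTypeR R := fun i x => x 0 i.

Let rV_set0 : g_sigma_preimage coor set0.
Proof. exact: sigma_algebra0. Qed.

Let rV_setC A : g_sigma_preimage coor A -> g_sigma_preimage coor (~` A).
Proof. exact: sigma_algebraC. Qed.

Let rV_bigcup (F : _^nat) : (forall i, g_sigma_preimage coor (F i)) ->
  g_sigma_preimage coor (\bigcup_i (F i)).
Proof. exact: sigma_algebra_bigcup. Qed.

HB.instance Definition _ := @isMeasurable.Build
  (measure_rV_display (R.-ocitv.-measurable).-sigma)
  'rV[R]_n (g_sigma_preimage coor) rV_set0 rV_setC rV_bigcup.

End measurable_rV.

Section lebesgue_rV.
Local Open Scope ereal_scope.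
Context {R : realType}.

Definition rV_cons n (a : R) (x : 'rV[R]_n) : 'rV[R]_n.+1 :=
  \row_i oapp (x ord0) a (unlift ord0 i).

(* Lebesgue measure on R^n, as the n-fold product of the Lebesgue measure
   on R transported to row vectors; see lebesgue_rV_box. *)
Fixpoint lebesgue_rV n : set 'rV[R]_n -> \bar R :=
  match n with
  | 0 => \d_ (0%R : 'rV[R]_0)
  | m.+1 => pushforward (@lebesgue_rV m \x @lebesgue_measure R)
              (fun p => rV_cons p.2 p.1)
  end.

Lemma measurable_coor n (i : 'I_n) :
  measurable_fun [set: 'rV[R]_n] (fun x => x ord0 i : measurableTypeR R).
Proof.
move=> _ Y mY; rewrite setTI; apply: sub_sigma_algebra => /=.
rewrite -bigcup_seq/=; exists i => /=; first by rewrite mem_index_enum.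
by exists Y => //; rewrite setTI.
Qed.

Lemma measurable_fun_rVP d (T : measurableType d) n (f : T -> 'rV[R]_n) :
  (forall i, measurable_fun [set: T] (fun x => f x ord0 i : measurableTypeR R)) ->
  measurable_fun [set: T] f.
Proof.
move=> mf _ A; rewrite setTI; move: A.
pose S := [set A : set 'rV[R]_n | measurable (f @^-1` A)].
suff: (@measurable _ 'rV[R]_n) `<=` S by apply.
apply: smallest_sub.
  split; rewrite /S /=.
  - by rewrite preimage_set0.
  - by move=> A mA; rewrite setTD preimage_setC; exact: measurableC.
  - by move=> F mF; rewrite preimage_bigcup; exact: bigcup_measurable.
move=> A; rewrite -bigcup_seq => -[i _ [B mB <-]].
by rewrite /S /= setTI -[X in measurable X]setTI; exact: mf.
Qed.

Lemma measurable_rV_cons n : measurable_fun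
  [set: 'rV[R]_n * measurableTypeR R] (fun p => rV_cons p.2 p.1).
Proof.
apply: measurable_fun_rVP => i; rewrite /rV_cons.
under eq_fun do rewrite mxE.
case: unliftP => [j _|_] /=; last exact: measurable_snd.
exact: measurableT_comp (measurable_coor j) measurable_fst.
Qed.

Let uncons n (x : 'rV[R]_n.+1) : 'rV[R]_n * measurableTypeR R :=
  (\row_j x ord0 (lift ord0 j), x ord0 ord0).

Let measurable_uncons n : measurable_fun [set: 'rV[R]_n.+1] (@uncons n).
Proof.
apply: measurable_fun_pair; last exact: measurable_coor.
apply: measurable_fun_rVP => i; under eq_fun do rewrite mxE.
exact: measurable_coor.
Qed.

Let rV_consK n (p : 'rV[R]_n * measurableTypeR R) :
  uncons (rV_cons p.2 p.1) = p.
Proof.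
case: p => x a; rewrite /uncons /rV_cons /=; congr (_, _).
  by apply/rowP => j; rewrite !mxE liftK.
by rewrite mxE unlift_none.
Qed.

Lemma lebesgue_rV_subproof n :
  {m : {measure set 'rV[R]_n -> \bar R} |
    @lebesgue_rV n = m & sigma_finite setT m}.
Proof.
elim: n => [|n [m mE sm]].
  exists (\d_ (0%R : 'rV[R]_0) : {measure set _ -> \bar R}) => //.
  exact: sigma_finiteT.
pose P : {measure set ('rV[R]_n * measurableTypeR R)%type -> \bar R} :=
  (m \x @lebesgue_measure R :
    set ('rV[R]_n * measurableTypeR R)%type -> \bar R).
pose f (p : 'rV[R]_n * measurableTypeR R) := rV_cons p.2 p.1.
have mf : measurable_fun [set: 'rV[R]_n * measurableTypeR R] f.
  exact: measurable_rV_cons.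
pose Q : {measure set 'rV[R]_n.+1 -> \bar R} :=
  @measure_function_pushforward__canonical__measure_function_Measure
    _ _ _ _ R P f mf.
have sQ : sigma_finite setT Q.
  have /sigma_finiteP[F [TF ndF Foo]] := sm.
  have /sigma_finiteP[G [TG ndG Goo]] := sigma_finiteT (@lebesgue_measure R).
  exists (fun k => @uncons n @^-1` (F k `*` G k)).
    rewrite -preimage_bigcup (_ : \bigcup_k _ = setT) ?preimage_setT//.
    rewrite -subTset -setXTT TF TG => -[x y] [/= [i _ Fix] [j _ Gjy]].
    exists (maxn i j) => //; split => /=.
      by move: x Fix; exact/subsetPset/ndF/leq_maxl.
    by move: y Gjy; exact/subsetPset/ndG/leq_maxr.
  move=> k; have [mF Fk] := Foo k; have [mG Gk] := Goo k; split.
    rewrite -[X in measurable X]setTI.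
    by apply: measurable_uncons => //; exact: measurableX.
  rewrite /Q /= /pushforward -comp_preimage (_ : _ \o _ = id) ?preimage_id.
    by rewrite /P /= product_measure1E// lte_mul_pinfty// ge0_fin_numE.
  by apply/funext => p /=; rewrite rV_consK.
by exists Q; rewrite //= mE.
Qed.

Section instances.
Variable n : nat.
Let lam : {measure set 'rV[R]_n -> \bar R} := s2val (lebesgue_rV_subproof n).
Let lamE : @lebesgue_rV n = lam := s2valP (lebesgue_rV_subproof n).

Let lebesgue_rV0 : @lebesgue_rV n set0 = 0.
Proof. by rewrite lamE measure0. Qed.
Let lebesgue_rV_ge0 A : 0 <= @lebesgue_rV n A.
Proof. by rewrite lamE measure_ge0. Qed.
Let lebesgue_rV_sigma_additive : semi_sigma_additive (@lebesgue_rV n).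
Proof. by rewrite lamE; exact: measure_semi_sigma_additive. Qed.
Let lebesgue_rV_sigma_finite : sigma_finite setT (@lebesgue_rV n).
Proof. by rewrite lamE; exact: s2valP' (lebesgue_rV_subproof n). Qed.

HB.instance Definition _ := isMeasure.Build _ _ _ (@lebesgue_rV n)
  lebesgue_rV0 lebesgue_rV_ge0 lebesgue_rV_sigma_additive.
HB.instance Definition _ := Measure_isSigmaFinite.Build _ _ _ (@lebesgue_rV n)
  lebesgue_rV_sigma_finite.
End instances.

Lemma lebesgue_rV_box n (B : 'I_n -> set (measurableTypeR R)) :
  (forall i, measurable (B i)) ->
  lebesgue_rV [set x : 'rV[R]_n | forall i, B i (x ord0 i)] =
  \prod_(i < n) lebesgue_measure (B i).
Proof.
elim: n B => [|n IH] B mB.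
  by rewrite big_ord0 /= diracE mem_set// => -[].
rewrite big_ord_recl /= /pushforward muleC -(IH (fun i => B (lift ord0 i)))//.
rewrite -product_measure1E//; last first.
  have -> : [set x : 'rV[R]_n | forall i, B (lift ord0 i) (x ord0 i)] =
      \bigcap_(i in [set: 'I_n]) ((fun x : 'rV[R]_n => x ord0 i) @^-1` B (lift ord0 i)).
    by apply/seteqP; split => x Bx i; [move=> _; exact: Bx|exact: Bx].
  apply: fin_bigcap_measurable => // i _.
  rewrite -[X in measurable X]setTI; exact: measurable_coor.
congr (_ _); apply/seteqP; split => -[x a] /=.
  move=> H; split=> [i|].
    by have := H (lift ord0 i); rewrite mxE liftK.
  by have := H ord0; rewrite mxE unlift_none.
by move=> [Hx Ha] i; rewrite mxE; case: unliftP => [j ->|->].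
Qed.

End lebesgue_rV.
Arguments lebesgue_rV {R n}.

Lemma open_measurable_rV (R : realType) n (U : set 'rV[R]_n) :
  open U -> measurable U.
Proof.
move=> oU.
pose B (p : 'rV[rat]_n * nat) : set 'rV[R]_n :=
  ball (map_mx ratr p.1 : 'rV[R]_n) p.2.+1%:R^-1.
have mB p : measurable (B p).
  have -> : B p = \bigcap_(i in [set: 'I_n])
      ((fun x : 'rV[R]_n => x ord0 i : measurableTypeR R) @^-1`
        ball (ratr (p.1 ord0 i) : R) p.2.+1%:R^-1).
    apply/seteqP; split => x; rewrite /B.
      by move=> [_ bx] i _ /=; have := bx ord0 i; rewrite mxE.
    move=> bx; split=> [|a i]; first by rewrite invr_gt0.
    by rewrite ord1 mxE; exact: bx.
  apply: fin_bigcap_measurable => // i _.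
  rewrite -[X in measurable X]setTI; apply: measurable_coor => //.
  by rewrite ball_itv; exact: measurable_itv.
pose F k := if unpickle k is Some p then
  if pselect (B p `<=` U) then B p else set0 else set0.
have -> : U = \bigcup_k F k.
  apply/seteqP; split => [x Ux|x [k _]]; last first.
    rewrite /F; case: unpickle => // p.
    by case: pselect => // BU /BU.
  have /nbhs_ballP[e /= e0 eU] : nbhs x U by exact: open_nbhs_nbhs.
  have [k ke] : exists k : nat, (k.+1%:R^-1 : R) < e / 2.
    have e2 : 0 < e / 2 by rewrite divr_gt0.
    exists (Num.truncn (e / 2)^-1).
    by rewrite invf_plt ?posrE// truncnS_gt.
  have h i : exists q : rat, `|ratr q - x ord0 i| < k.+1%:R^-1 :> R.
    have [|q] := @rat_in_itvoo R (x ord0 i - k.+1%:R^-1) (x ord0 i + k.+1%:R^-1).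
      by rewrite ltrBlDr -addrA ltrDl addr_gt0.
    by rewrite in_itv/= => hq; exists q; rewrite ltr_distl.
  have [q hq] := choice h.
  pose p : 'rV[rat]_n * nat := (\row_i q i, k).
  exists (pickle p) => //; rewrite /F pickleK.
  have bx : B p x.
    split=> [|a i]; first by rewrite invr_gt0.
    by rewrite ord1 !mxE /ball /=; exact: hq.
  case: pselect => //; case => y By; apply: eU.
  rewrite (splitr e); apply: (@ball_triangle _ _ (map_mx ratr p.1 : 'rV[R]_n)).
    by apply: le_ball (ltW ke) _ _; exact: ball_sym.
  by apply: le_ball (ltW ke) _ _.
apply: bigcupT_measurable => k; rewrite /F.
case: (unpickle k) => [p|]; last exact: measurable0.
by case: pselect => [BU|nBU]; [exact: mB|exact: measurable0].
Qed.

(* C^k on R^n: all partial derivatives of order <= k exist everywhere and are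
   continuous. *)
Fixpoint Ck (R : realType) (n k : nat) (f : 'rV[R]_n -> R) : Prop :=
  match k with
  | 0 => continuous f
  | j.+1 => continuous f /\ forall i : 'I_n,
      (forall x, derivable f x (delta_mx 0 i)) /\
      Ck j ('D_(delta_mx 0 i) f)
  end.

(* Elements of C_c^oo(D) are identified with their extensions by zero. *)
Definition Cc_smooth (R : realType) (n : nat) (D : set 'rV[R]_n)
    (f : 'rV[R]_n -> R) : Prop :=
  (forall k, Ck k f) /\
  compact (closure [set x | f x != 0]) /\
  closure [set x | f x != 0] `<=` D.

Definition domain (R : realType) (n : nat) (D : set 'rV[R]_n) : Prop :=
  [/\ D !=set0, connected D & open D].

Definition boundary (T : topologicalType) (D : set T) : set T :=
  closure D `\` interior D.

Definition linear_isometry (R : realType) (n : nat)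
    (L : {linear 'rV[R]_n -> 'rV[R]_n}) : Prop :=
  forall x, enorm (L x) = enorm x.

Definition lipschitz_with (R : realType) (n : nat) (K : R)
    (phi : 'rV[R]_n -> R) : Prop :=
  forall x y, `|phi x - phi y| <= K * enorm (x - y).

(* x = (rV_init x, x 0 ord_max) splits off the last coordinate. *)
Definition rV_init (R : realType) (n : nat) (x : 'rV[R]_n.+1) : 'rV[R]_n :=
  \row_i x 0 (widen_ord (leqnSn n) i).

Definition lipschitz_domain (R : realType) (n : nat) (D : set 'rV[R]_n.+1) :
    Prop :=
  [/\ domain D, bounded_set D &
    exists r0 K : R, 0 < r0 /\
      forall z, boundary D z ->
        exists (L : {linear 'rV[R]_n.+1 -> 'rV[R]_n.+1}) (phi : 'rV[R]_n -> R),
          [/\ linear_isometry L, lipschitz_with K phi &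
            L @` D `&` eball (L z) r0 =
            [set x | phi (rV_init x) < x 0 ord_max] `&` eball (L z) r0]].

(* Only the values of A on [0, +oo[ matter. *)
Definition N_function (R : realType) (A : R -> R) : Prop :=
  [/\ forall t, 0 <= t -> 0 <= A t,
      {within `[0, +oo[, continuous A},
      @convex_function R R^o `[0, +oo[ A,
      A t / t @[t --> 0^'+] --> 0 &
      A t / t @[t --> +oo] --> +oo].

Definition Delta2 (R : realType) (A : R -> R) : Prop :=
  exists2 p : R, 0 < p & forall t, 0 < t -> A (2 * t) <= p * A t.

Definition alpha (R : realType) (s : R) (A : R -> R) (lambda : R) : \bar R :=
  ereal_sup [set (A (lambda * t) / (lambda `^ s^-1 * A t))%:E | t in `]0, +oo[].

Definition delta (R : realType) (n : nat) (D : set 'rV[R]_n) (x : 'rV[R]_n) :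
  R := inf [set enorm (x - y) | y in ~` D].

(* On the diagonal the division by zero in the integrand of modular gives 0;
   the diagonal is a null set. The quotients in the two infima are taken in
   \bar R; their denominators are positive whenever f is not zero. *)
Section constants.
Local Open Scope ereal_scope.
Context {R : realType} (n : nat) (s : R) (A : R -> R) (D : set 'rV[R]_n).

Definition modular (f : 'rV[R]_n -> R) : \bar R :=
  \int[lebesgue_rV \x lebesgue_rV]_(z in D `*` D)
    (A (`|f z.1 - f z.2| / enorm (z.1 - z.2) `^ s)
       / enorm (z.1 - z.2) ^+ n)%:E.

Definition hardy_constant : \bar R :=
  ereal_inf [set modular f /
      \int[lebesgue_rV]_(x in D) (A (`|f x| / delta D x `^ s))%:E
    | f in [set f | Cc_smooth D f /\ f <> cst 0%R]].

Definition poincare_constant : \bar R :=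
  ereal_inf [set modular f / \int[lebesgue_rV]_(x in D) (A `|f x|)%:E
    | f in [set f | Cc_smooth D f /\ f <> cst 0%R]].

Definition FOHI : Prop := 0 < hardy_constant.
Definition RFOPI : Prop := 0 < poincare_constant.

End constants.

(* Main.v *)
Require Import Defs.
From mathcomp Require Import all_boot all_order all_algebra.
From mathcomp Require Import all_classical all_reals all_analysis.
From mathcomp Require Import measurable_realfun.
From mathcomp Require Import ring lra.
Set Implicit Arguments.
Unset Strict Implicit.
Unset Printing Implicit Defensive.
Import Order.TTheory GRing.Theory Num.Theory.
Import numFieldNormedType.Exports.
Local Open Scope classical_set_scope.
Local Open Scope ring_scope.

(** The Poincare inequality follows from the Hardy inequality since delta is
   bounded on D and A is doubling, so everything is about Hardy.

   The hypothesis on alpha generalizes s q > 1, its meaning for A t = t^q: for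
   every e there is th in ]0, 1[ with A (th^s t) <= e th A t for all t >= 0
   (limf_einf_alpha0).

   Fix a velocity w and let d x be the time at which the ray from x with
   velocity w leaves D.  A Hardy inequality holds along these rays (ray_hardy),
   by absorption.  Compare f x with f y, where y = x + r w and r runs over
   [(1 - th) d x, (1 - th / 2) d x], so that d y = d x - r is comparable with
   th d x.  By convexity and doubling, A (|f x| / d x ^ s) is at most a multiple
   of A (|f x - f y| / r ^ s) plus a multiple, of order e th, of
   A (|f y| / d y ^ s).  Averaging over r and integrating over x, the map from
   x to y contracts lengths along the ray by a factor of order th, so the factor
   th is used up and there remains p e times the original integral, with p the
   doubling constant.  Choosing e with p e <= 1 / 2, this term is absorbed in
   the left-hand side, which is finite because f has compact support.  The
   vanishing of f at the boundary enters only through this finiteness.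
   Averaging over r turns the contraction, which would require the structure
   of the components of D on each line, into a mere translation of x for
   each r.

   Now integrate over the velocities w with 1 <= |w| <= 4.  On the right-hand
   side the substitution y = x + r w turns the integral over w and r into the
   modular of f: this is integration in polar coordinates with a thick sphere,
   and it requires only translations and dilations of the Lebesgue measure
   (ge0_integral_affine_rV).  On the left-hand side, the Lipschitz condition
   yields an exterior cone at each boundary point, so that a set of velocities
   of measure bounded below leads from x outside D within time delta D x
   (exterior_directions); for those d x <= delta D x.  The outcome is
   directional_hardy. *)

(** * The Euclidean norm and measurability *)

Section enorm.
Context {R : realType} {n : nat}.
Implicit Types (x y : 'rV[R]_n) (k : R).

Lemma enorm_ge0 x : 0 <= enorm x.
Proof. exact: sqrtr_ge0. Qed.

Lemma enorm_sqr x : enorm x ^+ 2 = \sum_(i < n) x 0 i ^+ 2.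
Proof. by rewrite sqr_sqrtr// sumr_ge0// => i _; exact: sqr_ge0. Qed.

Lemma enormZ k x : enorm (k *: x) = `|k| * enorm x.
Proof.
rewrite /enorm -sqrtr_sqr -sqrtrM ?sqr_ge0// mulr_sumr.
by congr Num.sqrt; apply: eq_bigr => i _; rewrite mxE exprMn.
Qed.

Lemma enormN x : enorm (- x) = enorm x.
Proof. by rewrite -scaleN1r enormZ normrN1 mul1r. Qed.

Lemma enorm0 : enorm (0 : 'rV[R]_n) = 0.
Proof. by rewrite -(scale0r 0) enormZ normr0 mul0r. Qed.

Lemma enormB x y : enorm (x - y) = enorm (y - x).
Proof. by rewrite -enormN opprB. Qed.

Lemma ler_coor_enorm x (i : 'I_n) : `|x 0 i| <= enorm x.
Proof.
rewrite -sqrtr_sqr ler_sqrt ?sumr_ge0// => [|j _]; last exact: sqr_ge0.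
by rewrite (bigD1 i)//= lerDl sumr_ge0// => j _; exact: sqr_ge0.
Qed.

(** The Cauchy-Schwarz inequality. *)
Lemma ler_sum_coor x y :
  \sum_(i < n) x 0 i * y 0 i <= enorm x * enorm y.
Proof.
rewrite (le_trans (ler_norm _))// -sqrtr_sqr -sqrtrM; last first.
  by apply: sumr_ge0 => i _; exact: sqr_ge0.
rewrite ler_sqrt; last first.
  by rewrite mulr_ge0// sumr_ge0// => i _; exact: sqr_ge0.
(* the sum of the squares of the 2 x 2 minors is nonnegative *)
have : 0 <= \sum_(i < n) \sum_(j < n) (x 0 i * y 0 j - x 0 j * y 0 i) ^+ 2.
  by apply: sumr_ge0 => i _; apply: sumr_ge0 => j _; exact: sqr_ge0.
set S := \sum_i x 0 i * y 0 i.
set X := \sum_i x 0 i ^+ 2; set Y := \sum_i y 0 i ^+ 2.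
have -> : \sum_(i < n) \sum_(j < n) (x 0 i * y 0 j - x 0 j * y 0 i) ^+ 2 =
    X * Y + Y * X - 2 * (S * S).
  rewrite /X /Y /S !big_distrlr/= mulr_sumr -big_split/= -sumrB.
  apply: eq_bigr => i _; rewrite mulr_sumr -big_split/= -sumrB.
  by apply: eq_bigr => j _; ring.
by rewrite expr2 => ?; lra.
Qed.

Lemma ler_enormD x y : enorm (x + y) <= enorm x + enorm y.
Proof.
rewrite -ler_sqr ?nnegrE ?addr_ge0 ?enorm_ge0// sqrrD !enorm_sqr.
have -> : \sum_(i < n) (x + y) 0 i ^+ 2 = \sum_(i < n) x 0 i ^+ 2 +
    (\sum_(i < n) x 0 i * y 0 i) *+ 2 + \sum_(i < n) y 0 i ^+ 2.
  rewrite -sumrMnl -!big_split/=; apply: eq_bigr => i _.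
  by rewrite mxE sqrrD.
by rewrite lerD2r lerD2l lerMn2r ler_sum_coor.
Qed.

Lemma ler_enormB x y : enorm x - enorm y <= enorm (x - y).
Proof. by rewrite lerBlDr -{1}(subrK y x) ler_enormD. Qed.

Lemma ler_dist_enorm x y : `|enorm x - enorm y| <= enorm (x - y).
Proof.
by rewrite ler_norml ler_enormB lerNl opprB enormB ler_enormB.
Qed.

Lemma mx_norm_le_enorm x : `|x| <= enorm x.
Proof.
rewrite [leLHS]/Num.norm/= mx_normrE; apply/bigmax_leP; split=> [|[i j] _ /=].
  exact: enorm_ge0.
by rewrite ord1 ler_coor_enorm.
Qed.

Lemma enorm_le_mx_norm x : enorm x <= n%:R * `|x|.
Proof.
rewrite -[leRHS]ger0_norm ?mulr_ge0// -sqrtr_sqr ler_sqrt ?sqr_ge0//.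
apply: (@le_trans _ _ (\sum_(i < n) `|x| ^+ 2)).
  apply: ler_sum => i _; rewrite -real_normK ?num_real//.
  rewrite lerXn2r ?nnegrE//.
  rewrite [leRHS]/Num.norm/= mx_normrE; apply/bigmax_geP; right => /=.
  by exists (0, i).
rewrite sumr_const card_ord -[leLHS]mulr_natl exprMn; apply: ler_wpM2r.
  exact: sqr_ge0.
by rewrite -natrX ler_nat -mulnn; case: (n) => // k; rewrite leq_pmulr.
Qed.

Lemma enorm_gt0 x : (0 < enorm x) = (x != 0).
Proof.
rewrite lt_neqAle enorm_ge0 andbT eq_sym; congr negb.
apply/eqP/eqP => [x0|->]; last exact: enorm0.
by apply/eqP; rewrite -normr_le0 -x0 mx_norm_le_enorm.
Qed.

Lemma nbhs_eballP x (P : set 'rV[R]_n) :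
  nbhs x P <-> exists2 e : R, 0 < e & forall y, enorm (x - y) < e -> P y.
Proof.
split=> [/nbhs_ballP[e /= e0 eP]|[e e0 eP]].
  exists e => // y xy; apply: eP; rewrite -ball_normE/=.
  by rewrite (le_lt_trans (mx_norm_le_enorm _)).
apply/nbhs_ballP; exists (e / n.+1%:R) => /=; first by rewrite divr_gt0.
move=> y; rewrite -ball_normE/= => xy; apply: eP.
rewrite (le_lt_trans (enorm_le_mx_norm _))//.
have [->|] := eqVneq (x - y) 0; first by rewrite normr0 mulr0.
rewrite -normr_gt0 => xy0.
apply: (@lt_trans _ _ (n.+1%:R * `|x - y|)).
  by rewrite ltr_pM2r// ltr_nat.
by rewrite mulrC -ltr_pdivlMr.
Qed.

Lemma lipschitz_continuous (g : 'rV[R]_n -> R) K : 0 <= K ->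
  (forall x y, `|g x - g y| <= K * enorm (x - y)) -> continuous g.
Proof.
move=> K0 gK x; apply/(@cvgrPdist_lt _ _ _ _ (nbhs_filter x)) => e e0.
apply/nbhs_eballP; exists (e / (K + 1)) => [|y xy].
  by rewrite divr_gt0// ltr_wpDl.
rewrite (le_lt_trans (gK _ _))//.
rewrite ltr_pdivlMr ?ltr_wpDl// in xy.
have := enorm_ge0 (x - y); lra.
Qed.

Lemma enorm_continuous : continuous (@enorm R n).
Proof.
apply: (@lipschitz_continuous _ 1) => // x y.
by rewrite mul1r ler_dist_enorm.
Qed.

End enorm.

Section measurable_rV_functions.
Context {R : realType}.

Lemma continuous_measurable_rV n (g : 'rV[R]_n -> R) :
  continuous g -> measurable_fun [set: 'rV[R]_n] (g : _ -> measurableTypeR R).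
Proof.
move=> /continuousP cg; apply: (measurability _ (@RGenOpens.measurableE R)).
move=> _ [_ [a [b ->] <-]]; rewrite setTI; apply: open_measurable_rV.
exact/cg/interval_open.
Qed.

Lemma measurable_enorm n : measurable_fun [set: 'rV[R]_n] (@enorm R n).
Proof. by apply: continuous_measurable_rV; exact: enorm_continuous. Qed.

Lemma measurable_rVD d (T : measurableType d) n (f g : T -> 'rV[R]_n) :
  measurable_fun setT f -> measurable_fun setT g ->
  measurable_fun setT (fun x => f x + g x).
Proof.
move=> mf mg; apply: measurable_fun_rVP => i.
rewrite (_ : (fun x => _) = (fun x => f x ord0 i) \+ (fun x => g x ord0 i)).
  by apply: measurable_funD; exact: measurableT_comp (measurable_coor i) _.
by apply/funext => x /=; rewrite mxE.
Qed.

Lemma measurable_rVZ d (T : measurableType d) n (k : T -> R)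
    (f : T -> 'rV[R]_n) :
  measurable_fun setT k -> measurable_fun setT f ->
  measurable_fun setT (fun x => k x *: f x).
Proof.
move=> mk mf; apply: measurable_fun_rVP => i.
rewrite (_ : (fun x => _) = (k \* (fun x => f x ord0 i))).
  by apply: measurable_funM => //; exact: measurableT_comp (measurable_coor i) _.
by apply/funext => x /=; rewrite mxE.
Qed.

Lemma measurable_rVB d (T : measurableType d) n (f g : T -> 'rV[R]_n) :
  measurable_fun setT f -> measurable_fun setT g ->
  measurable_fun setT (fun x => f x - g x).
Proof.
move=> mf mg; apply: measurable_rVD => //.
under eq_fun do rewrite -scaleN1r.
exact: measurable_rVZ.
Qed.

End measurable_rV_functions.

Section measurable_kit.
Context {R : realType} d (T : measurableType d).
Implicit Types f g : T -> R.

Lemma measurable_mem (D : set T) : measurable D ->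
  measurable_fun setT (fun x => x \in D).
Proof.
move=> mD; apply: (measurable_fun_bool true).
rewrite setTI (_ : _ @^-1` _ = D)//.
by apply/seteqP; split => x /=; [exact: set_mem|exact: mem_set].
Qed.

Lemma measurable_powr f s : measurable_fun setT f ->
  measurable_fun setT (fun x => f x `^ s).
Proof. by move=> mf; exact: (measurableT_comp (measurable_powR s) mf). Qed.

(** Inversion on [0, +oo[ is the power function of exponent -1, whose
   measurability is known. *)
Lemma measurable_divr f g : (forall x, 0 <= g x) ->
  measurable_fun setT f -> measurable_fun setT g ->
  measurable_fun setT (fun x => f x / g x).
Proof.
move=> g0 mf mg; apply: measurable_funM => //.
under eq_fun do rewrite -powR_inv1//.
exact: measurable_powr.
Qed.

Lemma measurable_dist f g : measurable_fun setT f -> measurable_fun setT g ->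
  measurable_fun setT (fun x => `|f x - g x|).
Proof.
move=> mf mg; apply: (measurableT_comp (f := @Num.norm _ R)) => //.
exact: measurable_funB.
Qed.

End measurable_kit.

(** * Affine changes of variables *)

Section affine.
Context {R : realType}.
Notation mu := (@lebesgue_measure R).
Local Open Scope ereal_scope.

Lemma measurable_affine (a r : R) :
  measurable_fun [set: measurableTypeR R]
    (fun t : measurableTypeR R => (a + r * t)%R : measurableTypeR R).
Proof. by apply: measurable_funD => //; exact: measurable_funM. Qed.

(** Both sides are measures in X, so it is enough to compare them on
   intervals. *)
Lemma lebesgue_measure_affine (a r : R) (X : set (measurableTypeR R)) :
  (0 < r)%R -> measurable X ->
  mu ((fun t => a + r * t)%R @^-1` X) = (r^-1)%:E * mu X.
Proof.
move=> r0 mX.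
pose phi (t : measurableTypeR R) : measurableTypeR R := (a + r * t)%R.
have mphi : measurable_fun setT phi by exact: measurable_affine.
pose P : {measure set (measurableTypeR R) -> \bar R} :=
  @measure_function_pushforward__canonical__measure_function_Measure
    _ _ _ _ R mu phi mphi.
pose rr : {nonneg R} := NngNum (ltW r0).
suff -> : mu X = mscale rr P X.
  rewrite /mscale/= muleA -EFinM mulVf ?gt_eqF// mul1e.
  by rewrite /P /pushforward.
apply: lebesgue_measure_unique => // _ [[c d] _ <-].
rewrite [RHS](_ : _ = r%:E * mu (phi @^-1` `]c, d]%classic))//.
have -> : phi @^-1` `]c, d]%classic = `]((c - a) / r)%R, ((d - a) / r)%R]%classic.
  apply/seteqP; split => t /=; rewrite !in_itv/= ltr_pdivrMr// ler_pdivlMr//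
    ltrBlDl lerBrDl /phi (mulrC t) => -> //.
rewrite !lebesgue_measure_itv/= !lte_fin ltr_pM2r ?invr_gt0// ltrD2r.
case: ifP => cd; last by rewrite mule0.
rewrite -!EFinD -EFinM; congr EFin.
by rewrite -mulrBl mulrCA divff ?gt_eqF// mulr1 opprB addrA subrK.
Qed.

Lemma ge0_integral_affine (a r : R) (G : R -> \bar R) : (0 < r)%R ->
  measurable_fun [set: measurableTypeR R] G -> (forall t, 0 <= G t) ->
  \int[mu]_t G (a + r * t)%R = (r^-1)%:E * \int[mu]_t G t.
Proof.
move=> r0 mG G0.
have := @ge0_integral_pushforward _ _ _ _ R _ (measurable_affine a r) mu setT
  G measurableT mG (fun y _ => G0 y).
rewrite preimage_setT /= => <-.
pose rr : {nonneg R} := NngNum (ltW (eq_ind_r is_true r0 (invr_gt0 r))).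
rewrite -(@ge0_integral_mscale _ _ _ mu _ measurableT rr)//.
apply: eq_measure_integral => [|H X mX _]; first exact: measurable_affine.
exact: (lebesgue_measure_affine a r0 mX).
Qed.

Lemma ge0_integral_rV_recl n (F : 'rV[R]_n.+1 -> \bar R) :
  measurable_fun setT F -> (forall x, 0 <= F x) ->
  \int[lebesgue_rV]_x F x =
  \int[lebesgue_rV]_x \int[mu]_t F (rV_cons t x).
Proof.
move=> mF F0.
have := @ge0_integral_pushforward _ _ _ _ R _ (@measurable_rV_cons R n)
  (@lebesgue_rV R n \x mu) setT F measurableT mF (fun y _ => F0 y).
rewrite preimage_setT => /= H.
apply: (etrans H).
have mG : measurable_fun [set: 'rV[R]_n * measurableTypeR R]
    (F \o (fun p => rV_cons p.2 p.1)).
  by apply: measurableT_comp => //; exact: measurable_rV_cons.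
exact: (fubini_tonelli1 _ mG (fun p => F0 _)).
Qed.

Lemma measurable_affine_rV n (v : 'rV[R]_n) (r : R) :
  measurable_fun [set: 'rV[R]_n] (fun x => v + r *: x)%R.
Proof. by apply: measurable_rVD => //; exact: measurable_rVZ. Qed.

Lemma ge0_integral_affine_rV n (v : 'rV[R]_n) (r : R) (F : 'rV[R]_n -> \bar R) :
  (0 < r)%R -> measurable_fun setT F -> (forall x, 0 <= F x) ->
  \int[lebesgue_rV]_x F (v + r *: x)%R =
  (r ^- n)%:E * \int[lebesgue_rV]_x F x.
Proof.
move=> r0; elim: n v F => [|n IH] v F mF F0.
  rewrite expr0 invr1 mul1e; apply: eq_integral => x _.
  by congr F; apply/rowP => -[].
pose v' : 'rV[R]_n := (\row_i v ord0 (lift ord0 i))%R.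
have consE x t : (v + r *: rV_cons t x = rV_cons (v ord0 ord0 + r * t) (v' + r *: x))%R.
  apply/rowP => i; rewrite !mxE; case: unliftP => [j ->|->] //=.
  by rewrite !mxE.
have mF2 : measurable_fun [set: 'rV[R]_n * measurableTypeR R]
    (F \o (fun p => rV_cons p.2 p.1)).
  by apply: measurableT_comp => //; exact: measurable_rV_cons.
have mFaff : measurable_fun [set: 'rV[R]_n.+1] (fun x => F (v + r *: x)%R).
  apply: measurableT_comp => //; exact: measurable_affine_rV.
rewrite ge0_integral_rV_recl//.
transitivity (\int[lebesgue_rV]_x ((r^-1)%:E * \int[mu]_t
    F (rV_cons t (v' + r *: x)%R))).
  apply: eq_integral => x _.
  under eq_integral do rewrite consE.
  have mFx : measurable_fun [set: measurableTypeR R]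
      (fun t => F (rV_cons t (v' + r *: x)%R)).
    exact: (measurable_fun_pair2 (v' + r *: x)%R mF2).
  exact: (ge0_integral_affine (v ord0 ord0) r0 mFx).
have mG : measurable_fun [set: 'rV[R]_n] (fun x => \int[mu]_t F (rV_cons t x)).
  exact: (measurable_fun_fubini_tonelli_F _ mF2 (fun p => F0 _)).
rewrite ge0_integralZl//; last 3 first.
- apply: (measurableT_comp mG); exact: measurable_affine_rV.
- by move=> x _; exact: integral_ge0.
- by rewrite lee_fin invr_ge0 ltW.
rewrite (IH v' (fun x => \int[mu]_t F (rV_cons t x)))//; last first.
  by move=> x; exact: integral_ge0.
by rewrite muleA -EFinM -invfM -exprS -(ge0_integral_rV_recl mF F0).
Qed.

Lemma ge0_integral_translation n (v : 'rV[R]_n) (F : 'rV[R]_n -> \bar R) :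
  measurable_fun setT F -> (forall x, 0 <= F x) ->
  \int[lebesgue_rV]_x F (x + v)%R = \int[lebesgue_rV]_x F x.
Proof.
move=> mF F0; have := @ge0_integral_affine_rV n v 1 F ltr01 mF F0.
rewrite expr1n invr1 mul1e => <-.
by apply: eq_integral => x _; rewrite scale1r addrC.
Qed.

End affine.

(** * N-functions *)

Section N_function_theory.
Context {R : realType} (A : R -> R).
Hypothesis hA : N_function A.

Lemma N_function_ge0 t : 0 <= t -> 0 <= A t.
Proof. by case: hA => + _ _ _ _; exact. Qed.

Lemma N_function0 : A 0 = 0.
Proof.
case: hA => _ /continuous_within_itvcyP[_ A0] _ At0 _.
suff : A t @[t --> 0^'+] --> (0 : R) by move=> ?; exact: cvg_unique A0 _.
have : A t / t * t @[t --> 0^'+] --> (0 * 0 : R).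
  apply: cvgM => //; exact: cvg_at_right_filter.
rewrite mul0r; apply: cvg_trans; apply: near_eq_cvg.
near=> t; rewrite divfK// gt_eqF//.
Unshelve. all: by end_near. Qed.

Lemma N_function_conv k a b : 0 <= k <= 1 -> 0 <= a -> 0 <= b ->
  A (k * a + (1 - k) * b) <= k * A a + (1 - k) * A b.
Proof.
move=> k01 a0 b0; case: hA => _ _ /(_ (Itv01 (andP k01).1 (andP k01).2)) + _ _.
move=> /(_ a b); rewrite !inE/= !in_itv/= a0 b0 => /(_ isT isT).
by rewrite !convRE.
Qed.

Lemma N_function_le_mul k t : 0 <= k <= 1 -> 0 <= t -> A (k * t) <= k * A t.
Proof.
move=> k01 t0; have := N_function_conv k01 t0 (lexx 0).
by rewrite N_function0 !mulr0 !addr0.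
Qed.

Lemma N_function_homo a b : 0 <= a -> a <= b -> A a <= A b.
Proof.
move=> a0; rewrite le_eqVlt => /predU1P[->//|ab].
have b0 : 0 < b by exact: le_lt_trans ab.
have k01 : 0 <= a / b <= 1 by rewrite divr_ge0 ?(ltW b0)//= ler_pdivrMr// mul1r ltW.
have := N_function_le_mul k01 (ltW b0); rewrite divfK ?gt_eqF// => /le_trans; apply.
by case/andP: k01 => _ k1; rewrite ler_piMl ?N_function_ge0// ltW.
Qed.

(** Nothing is known of A on the negative half-line, hence the condition on
   the sign of g. *)
Lemma measurable_N_function d (T : measurableType d) (g : T -> R) :
  (forall x, 0 <= g x) -> measurable_fun setT g ->
  measurable_fun setT (fun x => A (g x)).
Proof.
move=> g0 mg; apply: (@measurable_comp _ _ _ T (measurableTypeR R) (measurableTypeR R)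
  `[0, +oo[%classic A setT g) => //.
- by move=> _ [x _ <-] /=; rewrite in_itv/= g0.
- by apply: subspace_continuous_measurable_fun => //; case: hA.
Qed.

Section Delta2.
Variable p : R.
Hypothesis A2 : forall t, 0 < t -> A (2 * t) <= p * A t.

Lemma Delta2_ge0 t : 0 <= t -> A (2 * t) <= p * A t.
Proof.
rewrite le_eqVlt => /predU1P[<-|]; last exact: A2.
by rewrite mulr0 N_function0 mulr0.
Qed.

(** Convexity at the midpoint of 2 a and 2 b, then doubling. *)
Lemma N_functionD a b : 0 <= a -> 0 <= b ->
  A (a + b) <= p / 2 * A a + p / 2 * A b.
Proof.
move=> a0 b0.
have h : 0 <= (2^-1 : R) <= 1 by lra.
have := N_function_conv h (mulr_ge0 (ler0n _ 2) a0) (mulr_ge0 (ler0n _ 2) b0).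
have := Delta2_ge0 a0; have := Delta2_ge0 b0.
have -> : 2^-1 * (2 * a) + (1 - 2^-1) * (2 * b) = a + b by field.
have -> : 1 - 2^-1 = 2^-1 :> R by field.
lra.
Qed.

Lemma Delta2_pow k t : 0 < p -> 0 <= t -> A (2 ^+ k * t) <= p ^+ k * A t.
Proof.
move=> p0 t0; elim: k => [|k IH]; first by rewrite !expr0 !mul1r.
rewrite !exprS -mulrA (le_trans (Delta2_ge0 _)) ?mulr_ge0 ?exprn_ge0//.
by rewrite -mulrA ler_wpM2l// ltW.
Qed.

(** A function satisfying the doubling condition cannot vanish at a positive
   point, as it would vanish at arbitrarily large ones. *)
Lemma N_function_gt0 t : 0 < p -> 0 < t -> 0 < A t.
Proof.
move=> p0 t0; rewrite lt_neqAle N_function_ge0 1?ltW// andbT eq_sym.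
apply/eqP => At0.
have A0 u : 0 <= u -> A u = 0.
  move=> u0; apply/eqP; rewrite eq_le N_function_ge0// andbT.
  have [k uk] : exists k : nat, u <= 2 ^+ k * t.
    exists (Num.truncn (u / t)).+1; rewrite -ler_pdivrMr//.
    rewrite (le_trans (ltW (truncnS_gt _)))// -natrX ler_nat.
    exact/ltnW/ltn_expl.
  rewrite (le_trans (N_function_homo u0 uk))//.
  by rewrite (le_trans (Delta2_pow _ p0 (ltW t0)))// At0 mulr0.
case: hA => _ _ _ _ /cvgryPge/(_ 1)[M [_ MA]].
have M1 : M < `|M| + 1 by rewrite (le_lt_trans (ler_norm M))// ltrDl.
have := MA _ M1; rewrite A0; last by rewrite addr_ge0.
by rewrite mul0r ler10.
Qed.

End Delta2.

(** Along suitable small dilations the function decays faster than the power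
   with exponent the inverse of s. *)
Lemma limf_einf_alpha0 s p e : 0 < s -> 0 < p ->
  (forall t, 0 < t -> A (2 * t) <= p * A t) ->
  limf_einf (alpha s A) (0^'+) = 0%E -> 0 < e ->
  exists2 l : R, 0 < l < 1 &
    forall t, 0 <= t -> A (l * t) <= e * l `^ s^-1 * A t.
Proof.
move=> s0 p0 A2; rewrite limf_einfE => lim0 e0.
have /ereal_inf_lt[_ [l /= l01 <-]] :
    (ereal_inf (alpha s A @` `]0%R, 1%R[%classic) < e%:E)%E.
  apply: (@le_lt_trans _ _ 0%E); last by rewrite lte_fin.
  rewrite -lim0; apply: ereal_sup_ubound; exists `]0%R, 1%R[%classic => //.
  by near=> t; rewrite /= in_itv/=; apply/andP; split => //; near: t;
    apply: nbhs_right_lt.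
rewrite in_itv/= in l01 => ale; exists l => // t.
rewrite le_eqVlt => /predU1P[<-|t0]; first by rewrite mulr0 N_function0 mulr0.
have At0 : 0 < A t by exact: N_function_gt0 A2 _ p0 t0.
have lp : 0 < l `^ s^-1 * A t by rewrite mulr_gt0// powR_gt0; case/andP: l01.
rewrite -mulrA -ler_pdivrMr//.
rewrite -lee_fin (le_trans _ (ltW ale))//; apply: ereal_sup_ubound.
by exists t => //=; rewrite in_itv/= t0.
Unshelve. all: by end_near. Qed.

End N_function_theory.

(** * Distance to the complement and exit times *)

Section distance_to_complement.
Context {R : realType} {n : nat} (D : set 'rV[R]_n).
Hypothesis CD0 : ~` D !=set0.
Implicit Types x y : 'rV[R]_n.

Let S x := [set enorm (x - y) | y in ~` D].

Let S0 x : S x !=set0.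
Proof. by case: CD0 => y Dy; exists (enorm (x - y)); exists y. Qed.

Let lbS x : lbound (S x) 0.
Proof. by move=> _ [y _ <-]; exact: enorm_ge0. Qed.

Lemma delta_le x y : ~ D y -> delta D x <= enorm (x - y).
Proof. by move=> Dy; apply: ge_inf; [exists 0; exact: lbS|exists y]. Qed.

Lemma delta_lt x y : enorm (x - y) < delta D x -> D y.
Proof. by apply: contraPP => /(delta_le x); rewrite leNgt => /negP. Qed.

Lemma delta_adherent x e : 0 < e ->
  exists2 y, ~ D y & enorm (x - y) < delta D x + e.
Proof.
move=> e0; have [|_ [y Dy <-] ye] := @inf_adherent _ (S x) _ e0.
  by split => //; exists 0; exact: lbS.
by exists y.
Qed.

Lemma delta_lipschitz x y : `|delta D x - delta D y| <= enorm (x - y).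
Proof.
have h u v : delta D u - delta D v <= enorm (u - v).
  apply/ler_addgt0Pr => e e0; have [z Dz vz] := delta_adherent v e0.
  have := delta_le u Dz; have := ler_enormD (u - v) (v - z).
  rewrite addrA subrK; lra.
by rewrite ler_norml h lerNl opprB enormB h.
Qed.

Lemma delta_continuous : continuous (delta D).
Proof.
apply: (@lipschitz_continuous _ _ _ 1) => // x y.
by rewrite mul1r delta_lipschitz.
Qed.

Lemma delta_gt0 x : open D -> D x -> 0 < delta D x.
Proof.
move=> oD Dx; have /nbhs_eballP[e e0 eD] : nbhs x D by exact: open_nbhs_nbhs.
apply: (lt_le_trans e0); apply: lb_le_inf; first exact: S0.
move=> _ [y Dy <-]; 
by rewrite leNgt; apply/negP => /eD.
Qed.

End distance_to_complement.

(** When D is open and bounded and w is nonzero, the infimum is attained: see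
   exit_point_notin. *)
Definition exit_time {R : realType} {n : nat} (D : set 'rV[R]_n) (w x : 'rV[R]_n)
  : R := inf [set r | 0 <= r /\ ~ D (x + r *: w)].

Section exit_time.
Context {R : realType} {n : nat} (D : set 'rV[R]_n) (M : R).
Hypothesis oD : open D.
Hypothesis CD0 : ~` D !=set0.
Hypothesis DM : forall x, D x -> enorm x <= M.
Variable w : 'rV[R]_n.
Hypothesis w0 : w != 0.
Implicit Types x y : 'rV[R]_n.

Local Notation d := (exit_time D w).
Let S x := [set r | 0 <= r /\ ~ D (x + r *: w)].

Let lbS x : lbound (S x) 0.
Proof. by move=> r []. Qed.

Let S0 x : S x !=set0.
Proof.
have ew0 : 0 < enorm w by rewrite enorm_gt0.
exists ((`|M| + 1 + enorm x) / enorm w); split.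
  by rewrite divr_ge0 ?addr_ge0 ?enorm_ge0.
move=> /DM; apply/negP; rewrite -ltNge.
have := ler_enormB (((`|M| + 1 + enorm x) / enorm w) *: w) (- x).
rewrite opprK enormN enormZ ger0_norm; last first.
  by rewrite divr_ge0 ?addr_ge0 ?enorm_ge0.
rewrite divfK ?gt_eqF// (addrC _ x); have := ler_norm M; lra.
Qed.

Lemma exit_time_ge0 x : 0 <= d x.
Proof. by apply: lb_le_inf; [exact: S0|exact: lbS]. Qed.

Lemma exit_time_le x r : 0 <= r -> ~ D (x + r *: w) -> d x <= r.
Proof. by move=> r0 Dx; apply: ge_inf; [exists 0; exact: lbS|split]. Qed.

Lemma lt_exit_time x r : 0 <= r -> r < d x -> D (x + r *: w).
Proof.
by move=> r0; apply: contraPP => /(exit_time_le r0); rewrite leNgt => /negP.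
Qed.

Lemma exit_time_ge x b :
  (forall r, 0 <= r -> r < b -> D (x + r *: w)) -> b <= d x.
Proof.
move=> h; apply: lb_le_inf; first exact: S0.
move=> r [r0 Dr]; rewrite leNgt.
by apply/negP => /(h _ r0).
Qed.

Lemma delta_le_exit_time x : delta D x <= enorm w * d x.
Proof.
have ew0 : 0 < enorm w by rewrite enorm_gt0.
rewrite mulrC -ler_pdivrMr//; apply: exit_time_ge => r r0 rlt.
apply: (@delta_lt _ _ _ x); rewrite opprD addNKr enormN enormZ ger0_norm//.
by rewrite -ltr_pdivlMr.
Qed.

Lemma exit_time_gt0 x : D x -> 0 < d x.
Proof.
move=> Dx; have := delta_le_exit_time x; have := delta_gt0 CD0 oD Dx.
by move=> d0 /(lt_le_trans d0); rewrite pmulr_rgt0// enorm_gt0.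
Qed.

(** Moving along the ray consumes the remaining time at unit speed: this is
   the property of the exit time on which the ray inequality rests. *)
Lemma exit_time_shift x r : 0 <= r -> r < d x -> d (x + r *: w) = d x - r.
Proof.
move=> r0 rd; apply/eqP; rewrite eq_le; apply/andP; split.
  rewrite lerBrDr; apply: exit_time_ge => t t0 td.
  have [tr|rt] := ltP t r; first by apply: lt_exit_time => //; exact: lt_trans rd.
  have -> : x + t *: w = (x + r *: w) + (t - r) *: w.
    by rewrite -addrA -scalerDl (addrC r) subrK.
  by apply: lt_exit_time; rewrite ?subr_ge0// ltrBlDr.
apply: exit_time_ge => t t0; rewrite ltrBrDl => td.
by rewrite -addrA -scalerDl; apply: lt_exit_time => //; exact: addr_ge0.
Qed.

Lemma exit_point_notin x : ~ D (x + d x *: w).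
Proof.
move=> Dx; have := exit_time_gt0 Dx; apply/negP; rewrite -leNgt.
set y := x + d x *: w; rewrite -(lerD2l (d x)) addr0; apply: exit_time_ge.
move=> t t0 td.
have [tr|rt] := ltP t (d x); first exact: lt_exit_time.
have -> : x + t *: w = y + (t - d x) *: w.
  by rewrite /y -addrA -scalerDl (addrC (d x)) subrK.
by apply: lt_exit_time; rewrite ?subr_ge0// ltrBlDl.
Qed.

(** By compactness a segment of a ray lying in D keeps a positive distance
   from the complement, so nearby parallel segments lie in D too. *)
Lemma open_exit_time_gt q : open [set x | q < d x].
Proof.
have [q0|q0] := ltP q 0.
  rewrite (_ : [set _ | _] = setT); first exact: openT.
  by apply/seteqP; split => // x _ /=; rewrite (lt_le_trans q0)// exit_time_ge0.
rewrite openE => x /= qd; apply/nbhs_eballP.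
pose q' := (q + d x) / 2.
have q'0 : 0 <= q' by rewrite /q'; lra.
have [qq' q'd] : q < q' /\ q' < d x by rewrite /q'; split; lra.
have cg : {within `[0, q'], continuous (fun t : R => delta D (x + t *: w))}.
  apply: continuous_subspaceT => t.
  apply: (@continuous_comp _ _ _ (fun t : R => x + t *: w) (delta D)); last first.
    exact: (delta_continuous CD0).
  by apply: cvgD; [exact: cvg_cst|apply: cvgZl; exact: cvg_id].
(* c is the point of the segment which is closest to the complement of D *)
have [c] := EVT_min q'0 cg; rewrite in_itv/= => /andP[c0 cq'] cmin.
exists (delta D (x + c *: w)).
  by apply: delta_gt0 => //; apply: lt_exit_time => //; exact: le_lt_trans q'd.
move=> y xy; apply: (lt_le_trans qq'); apply: exit_time_ge => t t0 tq'.
apply: (@delta_lt _ _ _ (x + t *: w)).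
rewrite opprD addrACA subrr addr0 (lt_le_trans xy)//.
by apply: cmin; rewrite in_itv/= t0 ltW.
Qed.

Lemma measurable_exit_time :
  measurable_fun setT (d : 'rV[R]_n -> measurableTypeR R).
Proof.
apply: (measurability _ (@RGenOInfty.measurableE R)).
move=> _ [_ [q ->] <-]; rewrite setTI; apply: open_measurable_rV.
by rewrite preimage_itvoy; exact: open_exit_time_gt.
Qed.

End exit_time.

(** * The Hardy inequality along rays *)

Section ray_hardy.
Context {R : realType} {n : nat}.
Notation mu := (@lebesgue_measure R).
Variables (A : R -> R) (p s th e : R).
Hypothesis hA : N_function A.
Hypothesis p0 : 0 < p.
Hypothesis A2 : forall t, 0 < t -> A (2 * t) <= p * A t.
Hypothesis s0 : 0 < s.
Hypothesis th01 : 0 < th < 1.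
Hypothesis e0 : 0 <= e.
Hypothesis Ath : forall t, 0 <= t -> A (th `^ s * t) <= e * th * A t.
Hypothesis pe : p * e <= 2^-1.

Variables (D : set 'rV[R]_n) (M : R).
Hypothesis oD : open D.
Hypothesis CD0 : ~` D !=set0.
Hypothesis DM : forall x, D x -> enorm x <= M.
Variable w : 'rV[R]_n.
Hypothesis w0 : w != 0.
Variable f : 'rV[R]_n -> R.
Hypothesis mf : measurable_fun [set: 'rV[R]_n] (f : _ -> measurableTypeR R).

Local Notation d := (exit_time D w).

(** Integrand of the Hardy functional in which the exit time replaces the
   distance to the boundary. *)
Definition ray_density (x : 'rV[R]_n) : R :=
  if x \in D then A (`|f x| / d x `^ s) else 0.

(** Integrand at (x, r) of the one-dimensional modular along the ray from x. *)
Definition ray_quotient (z : 'rV[R]_n * measurableTypeR R) : R :=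
  if [&& z.1 \in D, z.1 + z.2 *: w \in D & 0 < z.2]
  then A (`|f z.1 - f (z.1 + z.2 *: w)| / z.2 `^ s) / z.2 else 0.

(** The term to be absorbed, expressed at the arrival point y = x + r *: w:
   since d y = d x - r, the range of r in terms of d x becomes the range below
   in terms of d y. *)
Let H (z : 'rV[R]_n * measurableTypeR R) : R :=
  if ((th^-1 - 1) * d z.1 <= z.2) && (z.2 <= (2 / th - 1) * d z.1)
  then p * e * th / d z.1 * ray_density z.1 else 0.

Lemma ray_density_ge0 x : 0 <= ray_density x.
Proof.
rewrite /ray_density; case: ifP => // _; apply: (N_function_ge0 hA).
by rewrite divr_ge0 ?powR_ge0.
Qed.

Lemma ray_quotient_ge0 z : 0 <= ray_quotient z.
Proof.
rewrite /ray_quotient; case: ifP => // /and3P[_ _ z0].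
by rewrite divr_ge0 ?(ltW z0)//; apply: (N_function_ge0 hA); rewrite divr_ge0 ?powR_ge0.
Qed.

Let d_ge0 x : 0 <= d x.
Proof. exact: (exit_time_ge0 DM w0 x). Qed.

Let H_ge0 z : 0 <= H z.
Proof.
rewrite /H; case: ifP => // _; apply: mulr_ge0; last exact: ray_density_ge0.
case/andP: th01 => t0 _.
by rewrite !mulr_ge0// ?invr_ge0// ltW.
Qed.

(** With y = x + r *: w, split f x = (f x - f y) + f y.  As r < d x, the
   difference is controlled by ray_quotient; as d y <= th * d x, the value f y
   is controlled by the smallness of A along the dilation th `^ s. The factor
   2 / (th * d x) is the inverse of the length of the range of r. *)
Lemma ray_quotient_bound x r :
  D x -> (1 - th) * d x <= r -> r <= (1 - th / 2) * d x ->
  2 / (th * d x) * ray_density x <=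
  p / th * ray_quotient (x, r) + H (x + r *: w, r).
Proof.
move=> Dx r1 r2; case/andP: th01 => t0 t1.
have dx0 : 0 < d x by exact: (exit_time_gt0 oD CD0 DM w0 Dx).
have r0 : 0 < r by apply: lt_le_trans r1; rewrite mulr_gt0// subr_gt0.
have rd : r < d x.
  by apply: (le_lt_trans r2); rewrite gtr_pMl//; lra.
have Dy : D (x + r *: w) by exact: (lt_exit_time (ltW r0) rd).
have dy : d (x + r *: w) = d x - r by exact: (exit_time_shift DM w0 (ltW r0) rd).
rewrite /ray_quotient /H /ray_density /= !mem_set// r0 /= dy.
have -> : (th^-1 - 1) * (d x - r) <= r.
  by rewrite mulrBl mul1r lerBlDr subrKC ler_pdivrMl//; lra.
have -> /= : r <= (2 / th - 1) * (d x - r).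
  rewrite mulrBl mul1r lerBrDr subrKC mulrAC ler_pdivlMr//; lra.
set y := x + r *: w.
have dr0 : 0 < d x - r by rewrite subr_gt0.
have drth : d x - r <= th * d x by lra.
set ay := A (`|f y| / (d x - r) `^ s).
set bxy := A (`|f x - f y| / r `^ s).
have key : A (`|f x| / d x `^ s) <= p / 2 * bxy + p / 2 * (e * th * ay).
  have := @N_functionD _ _ hA _ A2 (`|f x - f y| / d x `^ s) (`|f y| / d x `^ s).
  rewrite !divr_ge0 ?powR_ge0// => /(_ isT isT) h.
  apply: le_trans (le_trans h _).
    apply: (N_function_homo hA); first by rewrite divr_ge0 ?powR_ge0.
    rewrite -mulrDl ler_wpM2r ?invr_ge0 ?powR_ge0//.
    by rewrite -{1}(subrK (f y) (f x)) ler_normD.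
  apply: lerD; rewrite ler_wpM2l ?divr_ge0 ?(ltW p0)//.
    apply: (N_function_homo hA); first by rewrite divr_ge0 ?powR_ge0.
    rewrite ler_wpM2l// lef_pV2 ?posrE ?powR_gt0//.
    by rewrite ge0_ler_powR ?nnegrE ?ltW.
  apply: le_trans (Ath _); last by rewrite divr_ge0 ?powR_ge0.
  apply: (N_function_homo hA); first by rewrite divr_ge0 ?powR_ge0.
  rewrite mulrCA ler_wpM2l//.
  rewrite ler_pdivlMr ?powR_gt0// mulrC ler_pdivrMr ?powR_gt0//.
  rewrite -powRM ?(ltW t0) ?(ltW dx0)//.
  by rewrite ge0_ler_powR ?nnegrE ?(ltW s0) ?(ltW dr0) ?mulr_ge0 ?(ltW t0) ?(ltW dx0).
have b0 : 0 <= bxy by apply: (N_function_ge0 hA); rewrite divr_ge0 ?powR_ge0.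
have a0 : 0 <= ay by apply: (N_function_ge0 hA); rewrite divr_ge0 ?powR_ge0.
have c0 : 0 <= 2 / (th * d x) by rewrite divr_ge0// mulr_ge0 ?ltW.
apply: (le_trans (ler_wpM2l c0 key)).
rewrite mulrDr; apply: lerD.
  have -> : 2 / (th * d x) * (p / 2 * bxy) = p / th * (bxy / d x).
    by field; rewrite !gt_eqF.
  rewrite ler_wpM2l ?divr_ge0 ?(ltW p0) ?(ltW t0)// ler_wpM2l//.
  by rewrite lef_pV2 ?posrE// ltW.
have -> : 2 / (th * d x) * (p / 2 * (e * th * ay)) = (p * e * ay) / d x.
  by field; rewrite !gt_eqF.
have -> : p * e * th / (d x - r) * ay = (p * e * ay) * (th / (d x - r)).
  by field; rewrite gt_eqF.
rewrite ler_wpM2l ?mulr_ge0 ?(ltW p0)//.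
by rewrite ler_pdivlMr// mulrC ler_pdivrMr.
Qed.

Let mD : measurable D. Proof. exact: open_measurable_rV. Qed.

Let md : measurable_fun setT (d : 'rV[R]_n -> measurableTypeR R).
Proof. exact: (measurable_exit_time oD CD0 DM w0). Qed.

Lemma measurable_ray_density :
  measurable_fun [set: 'rV[R]_n] (ray_density : _ -> measurableTypeR R).
Proof.
apply: measurable_fun_ifT => //; first exact: measurable_mem.
apply: (measurable_N_function hA) => [x|].
  by rewrite divr_ge0 ?powR_ge0.
apply: measurable_divr => [x||]; first exact: powR_ge0.
- exact: (measurableT_comp (f := @Num.norm _ R)).
- exact: measurable_powr.
Qed.

Let mflow : measurable_fun [set: 'rV[R]_n * measurableTypeR R]
  (fun z => z.1 + z.2 *: w).
Proof. by apply: measurable_rVD => //; exact: measurable_rVZ. Qed.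

Lemma measurable_ray_quotient :
  measurable_fun [set: 'rV[R]_n * measurableTypeR R]
    (ray_quotient : _ -> measurableTypeR R).
Proof.
pose b (z : 'rV[R]_n * measurableTypeR R) :=
  [&& z.1 \in D, z.1 + z.2 *: w \in D & 0 < z.2].
have mb : measurable_fun setT b.
  apply: measurable_and.
    exact: (measurableT_comp (measurable_mem mD) measurable_fst).
  apply: measurable_and.
    exact: (measurableT_comp (measurable_mem mD) mflow).
  exact: measurable_fun_ltr.
rewrite (_ : ray_quotient = fun z => if b z then
    A (`|f z.1 - f (z.1 + z.2 *: w)| / `|z.2| `^ s) / `|z.2| else 0); last first.
  apply/funext => z; rewrite /ray_quotient -/(b z); case: ifP => // /and3P[_ _ z0].
  by rewrite (gtr0_norm z0).
have mz2 : measurable_fun [set: 'rV[R]_n * measurableTypeR R] (fun z => `|z.2|).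
  exact: (measurableT_comp (f := @Num.norm _ R)).
apply: measurable_fun_ifT => //.
apply: measurable_divr => [z||//]; first exact: normr_ge0.
apply: (measurable_N_function hA) => [z|].
  by rewrite divr_ge0 ?powR_ge0.
apply: measurable_divr => [z||]; first exact: powR_ge0.
  apply: measurable_dist; first exact: (measurableT_comp mf measurable_fst).
  exact: (measurableT_comp mf mflow).
exact: measurable_powr.
Qed.

Let mH : measurable_fun [set: 'rV[R]_n * measurableTypeR R]
  (H : _ -> measurableTypeR R).
Proof.
have md1 : measurable_fun [set: 'rV[R]_n * measurableTypeR R] (fun z => d z.1).
  exact: (measurableT_comp md measurable_fst).
apply: measurable_fun_ifT => //.
  apply: measurable_and; apply: measurable_fun_ler => //;
    exact: measurable_funM.
apply: measurable_funM.
  by apply: measurable_divr => // z; exact: d_ge0.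
exact: (measurableT_comp measurable_ray_density measurable_fst).
Qed.

Local Open Scope ereal_scope.

(** The average over r of ray_quotient_bound. *)
Let ray_density_le x : (ray_density x)%:E <=
  \int[mu]_r (p / th * ray_quotient (x, r) + H (x + r *: w, r))%:E.
Proof.
have G0 r : (0 <= p / th * ray_quotient (x, r) + H (x + r *: w, r))%R.
  apply: addr_ge0 (H_ge0 _); apply: mulr_ge0; last exact: ray_quotient_ge0.
  by case/andP: th01 => t0 _; rewrite divr_ge0 ?(ltW p0) ?(ltW t0).
have [Dx|Dx] := pselect (D x); last first.
  rewrite {1}/ray_density memNset//; apply: integral_ge0 => r _.
  by rewrite lee_fin.
have dx0 : (0 < d x)%R by exact: (exit_time_gt0 oD CD0 DM w0 Dx).
case/andP: th01 => t0 t1.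
pose J := `[((1 - th) * d x)%R, ((1 - th / 2) * d x)%R]%classic.
have mJ : measurable (J : set (measurableTypeR R)) by exact: measurable_itv.
have muJ : mu J = (th * d x / 2)%:E.
  rewrite /J lebesgue_measure_itv/= lte_fin ltr_pM2r// ifT; last by lra.
  by rewrite -EFinD; congr EFin; lra.
have mG : measurable_fun [set: measurableTypeR R]
    (fun r => (p / th * ray_quotient (x, r) + H (x + r *: w, r))%:E).
  apply/measurable_EFinP; apply: measurable_funD.
    apply: measurable_funM => //.
    exact: (measurable_fun_pair2 x measurable_ray_quotient).
  apply: (measurableT_comp mH); apply: measurable_fun_pair => //.
  by apply: measurable_rVD => //; exact: measurable_rVZ.
have -> : (ray_density x)%:E =
    \int[mu]_(r in J) (cst (2 / (th * d x) * ray_density x)%:E) r.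
  rewrite integral_cst// [X in _ * X]muJ -EFinM; congr EFin.
  by field; rewrite !gt_eqF.
apply: (@le_trans _ _ (\int[mu]_(r in J)
    (p / th * ray_quotient (x, r) + H (x + r *: w, r))%:E)).
  apply: ge0_le_integral => //.
  - move=> r _; rewrite lee_fin mulr_ge0 ?ray_density_ge0//.
    by rewrite divr_ge0// mulr_ge0 ?ltW.
  - exact: measurable_funTS.
  - move=> r; rewrite /J/= in_itv/= => /andP[r1 r2].
    by rewrite lee_fin ray_quotient_bound.
by apply: ge0_subset_integral => // r _; rewrite lee_fin.
Qed.

(** The range of r in H has length d y / th, which compensates the factor
   th / d y exactly. *)
Let integral_H y : \int[mu]_r (H (y, r))%:E <= (p * e * ray_density y)%:E.
Proof.
case/andP: th01 => t0 t1.
pose J := `[((th^-1 - 1) * d y)%R, ((2 / th - 1) * d y)%R]%classic.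
have mJ : measurable (J : set (measurableTypeR R)) by exact: measurable_itv.
have HE : (fun r => (H (y, r))%:E) =
    (cst (p * e * th / d y * ray_density y)%:E) \_ J.
  apply/funext => r; rewrite /H /= patchE.
  by case: ifPn => rJ; [rewrite mem_set//|rewrite memNset//=; exact/negP].
rewrite HE -integral_mkcond integral_cst//.
rewrite [X in _ * X](_ : _ = (d y / th)%:E); last first.
  rewrite /J [LHS]lebesgue_measure_itv/= lte_fin.
  have := d_ge0 y; rewrite le_eqVlt => /predU1P[<-|dy0].
    by rewrite !mulr0 ltxx mul0r.
  rewrite ltr_pM2r// ifT; last first.
    by rewrite ltrD2r ltr_pMl ?invr_gt0// ltr1n.
  by rewrite -EFinD; congr EFin; field; rewrite gt_eqF.
rewrite -EFinM lee_fin.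
have := d_ge0 y; rewrite le_eqVlt => /predU1P[<-|dy0].
  rewrite mul0r mulr0 mulr_ge0 ?ray_density_ge0//.
  by rewrite mulr_ge0// ltW.
by rewrite le_eqVlt; apply/orP; left; apply/eqP; field; rewrite !gt_eqF.
Qed.

(** The term in H is at most half of the left-hand side, hence can be absorbed,
   the left-hand side being finite. *)
Lemma ray_hardy :
  \int[lebesgue_rV]_x (ray_density x)%:E < +oo ->
  \int[lebesgue_rV]_x (ray_density x)%:E <=
  (2 * p / th)%:E *
    \int[lebesgue_rV]_x \int[mu]_r (ray_quotient (x, r))%:E.
Proof.
case/andP: th01 => t0 t1 fin.
set I := \int[lebesgue_rV]_x _ in fin *.
set Q := \int[lebesgue_rV]_x \int[mu]_r _.
have I0 : 0 <= I by apply: integral_ge0 => x _; rewrite lee_fin ray_density_ge0.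
have mB : measurable_fun [set: 'rV[R]_n * measurableTypeR R]
    (fun z => (ray_quotient z)%:E).
  by apply/measurable_EFinP; exact: measurable_ray_quotient.
have B0 z : 0 <= (ray_quotient z)%:E by rewrite lee_fin ray_quotient_ge0.
have mshear : measurable_fun [set: 'rV[R]_n * measurableTypeR R]
    (fun z => (H (z.1 + z.2 *: w, z.2))%:E).
  apply/measurable_EFinP; apply: (measurableT_comp mH).
  exact: measurable_fun_pair.
have mHE : measurable_fun [set: 'rV[R]_n * measurableTypeR R]
    (fun z => (H z)%:E) by exact/measurable_EFinP.
have shear0 (z : 'rV[R]_n * measurableTypeR R) :
    0 <= (H (z.1 + z.2 *: w, z.2)%R)%:E by rewrite lee_fin.
have HE0 z : 0 <= (H z)%:E by rewrite lee_fin.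
have mIH : measurable_fun [set: 'rV[R]_n]
    (fun x => \int[mu]_r (H (x + r *: w, r))%:E).
  exact: (measurable_fun_fubini_tonelli_F _ mshear shear0).
have mIB : measurable_fun [set: 'rV[R]_n]
    (fun x => \int[mu]_r (ray_quotient (x, r))%:E).
  exact: (measurable_fun_fubini_tonelli_F _ mB B0).
have Hle : \int[lebesgue_rV]_x \int[mu]_r (H (x + r *: w, r))%:E <=
    (p * e)%:E * I.
  have -> : \int[lebesgue_rV]_x \int[mu]_r (H (x + r *: w, r))%:E =
      \int[mu]_r \int[lebesgue_rV]_x (H (x + r *: w, r))%:E.
    exact: (fubini_tonelli _ mshear shear0).
  (* for fixed r, the arrival point is a translate of x *)
  have -> : \int[mu]_r \int[lebesgue_rV]_x (H (x + r *: w, r))%:E =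
      \int[mu]_r \int[lebesgue_rV]_y (H (y, r))%:E.
    apply: eq_integral => r _.
    apply: (@ge0_integral_translation _ _ (r *: w) (fun y => (H (y, r))%:E)) => //.
    exact: (measurable_fun_pair1 r mHE).
  have <- : \int[lebesgue_rV]_y \int[mu]_r (H (y, r))%:E =
      \int[mu]_r \int[lebesgue_rV]_y (H (y, r))%:E.
    exact: (fubini_tonelli _ mHE HE0).
  rewrite /I -ge0_integralZl//; last 3 first.
  - by apply/measurable_EFinP; exact: measurable_ray_density.
  - by move=> x _; rewrite lee_fin ray_density_ge0.
  - by rewrite lee_fin mulr_ge0// ltW.
  apply: ge0_le_integral; first exact: measurableT.
  - by move=> x _; exact: integral_ge0.
  - exact: (measurable_fun_fubini_tonelli_F _ mHE HE0).
  - apply: measurable_funeM; by apply/measurable_EFinP; exact: measurable_ray_density.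
  - by move=> x _; rewrite -EFinM; exact: integral_H.
have main : I <= (p / th)%:E * Q + (p * e)%:E * I.
  apply: (@le_trans _ _ (\int[lebesgue_rV]_x
      ((p / th)%:E * (\int[mu]_r (ray_quotient (x, r))%:E) +
      \int[mu]_r (H (x + r *: w, r))%:E))).
    apply: ge0_le_integral => //.
    - by move=> x _; rewrite lee_fin ray_density_ge0.
    - by apply/measurable_EFinP; exact: measurable_ray_density.
    - by apply: emeasurable_funD => //; exact: measurable_funeM.
    - move=> x _; apply: (le_trans (ray_density_le x)).
      have mBx : measurable_fun [set: measurableTypeR R]
        (fun r => (ray_quotient (x, r))%:E) by exact: (measurable_fun_pair2 x mB).
      rewrite -ge0_integralZl//; last by rewrite lee_fin divr_ge0 ?(ltW p0) ?(ltW t0).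
      rewrite -ge0_integralD//; last 3 first.
      - by move=> r _; rewrite -EFinM lee_fin mulr_ge0 ?ray_quotient_ge0 ?divr_ge0 ?(ltW p0) ?(ltW t0).
      - exact: measurable_funeM.
      - exact: (measurable_fun_pair2 x mshear).
  rewrite ge0_integralD//; last 3 first.
  - by move=> x _; rewrite mule_ge0 ?lee_fin ?divr_ge0 ?(ltW p0) ?(ltW t0)//; exact: integral_ge0.
  - exact: measurable_funeM.
  - by move=> x _; exact: integral_ge0.
  rewrite ge0_integralZl//; last 2 first.
  - by move=> x _; exact: integral_ge0.
  - by rewrite lee_fin divr_ge0 ?(ltW p0) ?(ltW t0).
  exact: leeD2l.
have Ifin : I \is a fin_num by rewrite ge0_fin_numE.
have Q0 : 0 <= Q by apply: integral_ge0 => x _; exact: integral_ge0.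
have [->|Qfin] := eqVneq Q +oo.
  by rewrite gt0_muley ?leey// lte_fin divr_gt0// mulr_gt0.
have {Qfin}Qfin : Q \is a fin_num by rewrite ge0_fin_numE// ltey.
move: main I0; rewrite -(fineK Ifin) -(fineK Qfin) -!EFinM -EFinD !lee_fin.
move=> main I0; have := ler_wpM2r I0 pe; have -> : (2 * p / th = 2 * (p / th))%R by rewrite mulrA.
lra.
Qed.

End ray_hardy.

(** * Integration over the velocities *)

Section directions.
Context {R : realType} {n : nat}.
Notation mu := (@lebesgue_measure R).
Notation E := 'rV[R]_n.
Variables (A : R -> R) (p s th e : R).
Hypothesis hA : N_function A.
Hypothesis p0 : 0 < p.
Hypothesis A2 : forall t, 0 < t -> A (2 * t) <= p * A t.
Hypothesis s01 : 0 < s < 1.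
Hypothesis th01 : 0 < th < 1.
Hypothesis e0 : 0 <= e.
Hypothesis Ath : forall t, 0 <= t -> A (th `^ s * t) <= e * th * A t.
Hypothesis pe : p * e <= 2^-1.

Variables (D : set E) (M : R).
Hypothesis oD : open D.
Hypothesis CD0 : ~` D !=set0.
Hypothesis DM : forall x, D x -> enorm x <= M.
Variable f : E -> R.
Hypothesis mf : measurable_fun [set: E] (f : _ -> measurableTypeR R).

Let s0 : 0 < s. Proof. by case/andP: s01. Qed.
Let mD : measurable D. Proof. exact: open_measurable_rV. Qed.

(** Any w with x + delta D x *: w outside D has norm at least 1; the factor 4
   leaves room for the balls of exterior_ball. The velocities of the annulus
   being comparable with 1, the time and the length of a ray are comparable. *)
Definition annulus : set E := [set w | 1 <= enorm w <= 4].

Let annulus_neq0 w : annulus w -> w != 0.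
Proof. by case/andP => w1 _; rewrite -enorm_gt0 (lt_le_trans _ w1). Qed.

Lemma measurable_annulus : measurable annulus.
Proof.
have := measurable_and (measurable_fun_ler (measurable_cst (1 : R))
  (@measurable_enorm R n)) (measurable_fun_ler (@measurable_enorm R n)
  (measurable_cst (4 : R))).
by move=> /(_ measurableT [set true] I); rewrite setTI.
Qed.

Definition hardy_density (x : E) : R := A (`|f x| / delta D x `^ s).

(** The Hardy density restricted to the velocities which lead out of D within
   time delta D x. *)
Let g (z : E * E) : R :=
  if [&& z.1 \in annulus, z.2 \in D & z.2 + delta D z.2 *: z.1 \in ~` D]
  then hardy_density z.2 else 0.

Let q (z : (E * E) * measurableTypeR R) : R :=
  if z.1.1 \in annulus then
    if [&& z.1.2 \in D, z.1.2 + z.2 *: z.1.1 \in D & 0 < z.2]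
    then A (`|f z.1.2 - f (z.1.2 + z.2 *: z.1.1)| / z.2 `^ s) / z.2 else 0
  else 0.

Let m (x y : E) : R := A (`|f x - f y| / enorm (x - y) `^ s).

(** Bound of q in terms of the time r and of the arrival point y = z.2, from
   which w is eliminated: |x - y| = r |w| lies between r and 4 r. *)
Let k (x : E) (z : measurableTypeR R * E) : R :=
  if [&& x \in D, z.2 \in D, 0 < z.1, z.1 <= enorm (x - z.2) &
      enorm (x - z.2) <= 4 * z.1]
  then m x z.2 / z.1 else 0.

Let hardy_density_ge0 x : 0 <= hardy_density x.
Proof. by apply: (N_function_ge0 hA); rewrite divr_ge0 ?powR_ge0. Qed.

Let m_ge0 x y : 0 <= m x y.
Proof. by apply: (N_function_ge0 hA); rewrite divr_ge0 ?powR_ge0. Qed.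

Let g_ge0 z : 0 <= g z.
Proof. by rewrite /g; case: ifP. Qed.

Let q_ge0 z : 0 <= q z.
Proof.
rewrite /q; case: ifP => // _; case: ifP => // /and3P[_ _ z0].
by rewrite divr_ge0 ?(ltW z0)//; apply: (N_function_ge0 hA); rewrite divr_ge0 ?powR_ge0.
Qed.

Let k_ge0 x z : 0 <= k x z.
Proof. by rewrite /k; case: ifP => // /and5P[_ _ z0 _ _]; rewrite divr_ge0// ltW. Qed.

Let g_le w x : annulus w -> g (w, x) <= ray_density A s D w f x.
Proof.
move=> Ww; rewrite /g /= mem_set//=; case: ifP; last first.
  by move=> _; exact: ray_density_ge0.
move=> /andP[xD /set_mem Dy]; rewrite /ray_density xD.
have w0 := annulus_neq0 Ww.
apply: (N_function_homo hA); first by rewrite divr_ge0 ?powR_ge0.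
have Dx := set_mem xD.
have d0 : 0 < exit_time D w x by exact: (exit_time_gt0 oD CD0 DM w0 Dx).
have dl0 := delta_gt0 CD0 oD Dx.
rewrite ler_wpM2l// lef_pV2 ?posrE ?powR_gt0//.
rewrite ge0_ler_powR ?nnegrE ?(ltW s0) ?(ltW d0) ?(ltW dl0)//.
by apply: exit_time_le => //; exact: ltW.
Qed.

Let qE w x r : annulus w -> q ((w, x), r) = ray_quotient A s D w f (x, r).
Proof. by move=> Ww; rewrite /q /= mem_set. Qed.

Let q_le w x r : q ((w, x), r) <= p ^+ 2 * k x (r, x + r *: w).
Proof.
have kk : 0 <= p ^+ 2 * k x (r, x + r *: w).
  by apply: mulr_ge0 (k_ge0 _ _); rewrite exprn_ge0 ?(ltW p0).
rewrite /q /=; case: ifP => // /set_mem /andP[w1 w4].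
case: ifP => // /and3P[xD yD r0].
have ey : enorm (x - (x + r *: w)) = r * enorm w.
  by rewrite opprD addrA subrr sub0r enormN enormZ gtr0_norm.
have w0 : 0 < enorm w by exact: lt_le_trans w1.
have r1 : r <= r * enorm w by rewrite ler_peMr// ltW.
have r4 : r * enorm w <= 4 * r by rewrite mulrC ler_pM2r.
rewrite /k /= xD yD r0 ey r1 r4 /=.
rewrite mulrA ler_pM2r ?invr_gt0//.
rewrite /m ey; set F := `|_|.
have F0 : 0 <= F by exact: normr_ge0.
apply: (@le_trans _ _ (A (2 ^+ 2 * (F / (r * enorm w) `^ s)))); last first.
  by apply: (Delta2_pow hA A2) => //; rewrite divr_ge0 ?powR_ge0.
apply: (N_function_homo hA); first by rewrite divr_ge0 ?powR_ge0.
rewrite mulrCA ler_wpM2l// ler_pdivlMr ?powR_gt0 ?mulr_gt0//.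
rewrite powRM ?(ltW r0) ?(ltW w0)// mulKf ?gt_eqF ?powR_gt0//.
rewrite (le_trans (_ : _ <= enorm w `^ 1))//.
  by rewrite ler_powR//; case/andP: s01 => _ /ltW.
by rewrite powRr1 ?(ltW w0)// (le_trans w4)// expr2; lra.
Qed.

Let mfst_mem d' (T : measurableType d') (h : T -> E) (X : set E) :
  measurable X -> measurable_fun setT h ->
  measurable_fun setT (fun z => h z \in X).
Proof. by move=> mX mh; exact: (measurableT_comp (measurable_mem mX) mh). Qed.

Let measurable_m d' (T : measurableType d') (h1 h2 : T -> E) :
  measurable_fun setT h1 -> measurable_fun setT h2 ->
  measurable_fun setT (fun z => m (h1 z) (h2 z) : measurableTypeR R).
Proof.
move=> mh1 mh2; apply: (measurable_N_function hA) => [z|].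
  by rewrite divr_ge0 ?powR_ge0.
apply: measurable_divr => [z||]; first exact: powR_ge0.
  by apply: measurable_dist; exact: (measurableT_comp mf).
apply: measurable_powr; apply: (measurableT_comp (@measurable_enorm R n)).
exact: measurable_rVB.
Qed.

Let mdelta : measurable_fun [set: E] (delta D : _ -> measurableTypeR R).
Proof. by apply: continuous_measurable_rV; exact: (delta_continuous CD0). Qed.

Lemma measurable_hardy_density :
  measurable_fun [set: E] (hardy_density : _ -> measurableTypeR R).
Proof.
apply: (measurable_N_function hA) => [z|].
  by rewrite divr_ge0 ?powR_ge0.
apply: measurable_divr => [z||]; first exact: powR_ge0.
  exact: (measurableT_comp (f := @Num.norm _ R)).
exact: measurable_powr.
Qed.

Let mg : measurable_fun [set: E * E] (g : _ -> measurableTypeR R).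
Proof.
apply: measurable_fun_ifT => //; last first.
  exact: (measurableT_comp measurable_hardy_density measurable_snd).
apply: measurable_and; first exact: mfst_mem measurable_annulus measurable_fst.
apply: measurable_and; first exact: mfst_mem mD measurable_snd.
apply: mfst_mem; first exact: measurableC.
apply: measurable_rVD => //; apply: measurable_rVZ => //.
exact: (measurableT_comp mdelta measurable_snd).
Qed.

Let mq : measurable_fun [set: (E * E) * measurableTypeR R]
  (q : _ -> measurableTypeR R).
Proof.
have m11 : measurable_fun [set: (E * E) * measurableTypeR R] (fun z => z.1.1).
  exact: (measurableT_comp measurable_fst measurable_fst).
have m12 : measurable_fun [set: (E * E) * measurableTypeR R] (fun z => z.1.2).
  exact: (measurableT_comp measurable_snd measurable_fst).
have mflow : measurable_fun [set: (E * E) * measurableTypeR R]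
    (fun z => z.1.2 + z.2 *: z.1.1).
  by apply: measurable_rVD => //; exact: measurable_rVZ.
pose b (z : (E * E) * measurableTypeR R) :=
  [&& z.1.2 \in D, z.1.2 + z.2 *: z.1.1 \in D & 0 < z.2].
have mb : measurable_fun setT b.
  apply: measurable_and; first exact: mfst_mem.
  apply: measurable_and; first exact: mfst_mem.
  exact: measurable_fun_ltr.
apply: measurable_fun_ifT => //; first exact: mfst_mem measurable_annulus m11.
rewrite (_ : (fun z => _) = fun z => if b z then
    A (`|f z.1.2 - f (z.1.2 + z.2 *: z.1.1)| / `|z.2| `^ s) / `|z.2| else 0); last first.
  apply/funext => z; rewrite -/(b z); case: ifP => // /and3P[_ _ z0].
  by rewrite (gtr0_norm z0).
have mz2 : measurable_fun [set: (E * E) * measurableTypeR R] (fun z => `|z.2|).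
  exact: (measurableT_comp (f := @Num.norm _ R)).
apply: measurable_fun_ifT => //.
apply: measurable_divr => [z||//]; first exact: normr_ge0.
apply: (measurable_N_function hA) => [z|].
  by rewrite divr_ge0 ?powR_ge0.
apply: measurable_divr => [z||]; first exact: powR_ge0.
  by apply: measurable_dist; exact: (measurableT_comp mf).
exact: measurable_powr.
Qed.

(** The kernel k together with the Jacobian of w |-> x + r *: w. *)
Let k' x (z : measurableTypeR R * E) : R := k x z / z.1 ^+ n.

Let k'_ge0 x z : 0 <= k' x z.
Proof.
rewrite /k' /k; case: ifP; last by rewrite mul0r.
by move=> /and5P[_ _ z0 _ _]; rewrite !divr_ge0 ?exprn_ge0 ?(ltW z0).
Qed.

Let menorm x : measurable_fun [set: measurableTypeR R * E]
  (fun z => enorm (x - z.2)).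
Proof.
apply: (measurableT_comp (@measurable_enorm R n)).
by apply: measurable_rVB.
Qed.

Let mkk x (h : measurableTypeR R * E -> R) :
  measurable_fun setT h ->
  measurable_fun [set: measurableTypeR R * E]
   (fun z => if [&& x \in D, z.2 \in D, 0 < z.1, z.1 <= enorm (x - z.2) &
      enorm (x - z.2) <= 4 * z.1] then h z else 0).
Proof.
move=> mh; apply: measurable_fun_ifT => //.
apply: measurable_and => //.
apply: measurable_and; first exact: mfst_mem.
apply: measurable_and; first exact: measurable_fun_ltr.
apply: measurable_and; apply: measurable_fun_ler => //.
exact: measurable_funM.
Qed.

Let mz1 : measurable_fun [set: measurableTypeR R * E] (fun z => `|z.1|).
Proof. exact: (measurableT_comp (f := @Num.norm _ R)). Qed.

Let mk x : measurable_fun [set: measurableTypeR R * E]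
  (k x : _ -> measurableTypeR R).
Proof.
rewrite (_ : k x = fun z => if [&& x \in D, z.2 \in D, 0 < z.1,
    z.1 <= enorm (x - z.2) & enorm (x - z.2) <= 4 * z.1]
    then m x z.2 / `|z.1| else 0); last first.
  apply/funext => z; rewrite /k; case: ifP => // /and5P[_ _ z0 _ _].
  by rewrite (gtr0_norm z0).
apply: mkk; apply: measurable_divr => //; exact: measurable_m.
Qed.

Let mk' x : measurable_fun [set: measurableTypeR R * E]
  (k' x : _ -> measurableTypeR R).
Proof.
rewrite (_ : k' x = fun z => k x z / `|z.1| ^+ n); last first.
  apply/funext => z; rewrite /k' /k; case: ifP; last by rewrite !mul0r.
  by move=> /and5P[_ _ z0 _ _]; rewrite (gtr0_norm z0).
apply: measurable_divr => //; first exact: mk.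
exact: measurable_funX.
Qed.

Definition modular_density (z : E * E) : R :=
  if (z.1 \in D) && (z.2 \in D) then m z.1 z.2 / enorm (z.1 - z.2) ^+ n else 0.

Let modular_density_ge0 z : 0 <= modular_density z.
Proof.
by rewrite /modular_density; case: ifP => // _; rewrite divr_ge0 ?exprn_ge0 ?enorm_ge0.
Qed.

Let measurable_modular_density : measurable_fun [set: E * E]
  (modular_density : _ -> measurableTypeR R).
Proof.
apply: measurable_fun_ifT => //.
  by apply: measurable_and; exact: mfst_mem.
apply: measurable_divr => [z||]; first by rewrite exprn_ge0 ?enorm_ge0.
  exact: measurable_m.
apply: measurable_funX; apply: (measurableT_comp (@measurable_enorm R n)).
exact: measurable_rVB.
Qed.

Local Open Scope ereal_scope.

Let mME : measurable_fun [set: E * E] (fun z => (modular_density z)%:E).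
Proof. by apply/measurable_EFinP; exact: measurable_modular_density. Qed.

Let ME0 z : 0 <= (modular_density z)%:E. Proof. by rewrite lee_fin. Qed.

Lemma modularE : modular s A D f =
  \int[lebesgue_rV]_x \int[lebesgue_rV]_y (modular_density (x, y))%:E.
Proof.
transitivity (\int[lebesgue_rV \x lebesgue_rV]_z (modular_density z)%:E); last first.
  exact: (fubini_tonelli1 _ mME ME0).
rewrite /modular integral_mkcond; apply: eq_integral => z _.
rewrite patchE /modular_density.
case: ifPn => [/set_mem[/= D1 D2]|zD]; first by rewrite !mem_set.
rewrite ifF//; apply/negP => /andP[/set_mem D1 /set_mem D2].
by move/negP: zD; apply; exact: mem_set.
Qed.

(** Integration over the thick radius: r ranges over [|x - y| / 4, |x - y|],
   where r ^- n.+1 is at most (4 / |x - y|) ^+ n.+1. *)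
Let integral_k' x y :
  \int[mu]_r (k' x (r, y))%:E <= (4 ^+ n.+1 * modular_density (x, y))%:E.
Proof.
rewrite /modular_density /=.
case: (boolP ((x \in D) && (y \in D))) => [/andP[xD yD]|xyD]; last first.
  rewrite mulr0 integral0_eq// => r _; congr EFin; rewrite /k' /k /=.
  rewrite ifF ?mul0r//; apply/negP => /and5P[xD yD _ _ _].
  by rewrite xD yD in xyD.
set rho := enorm (x - y).
have := enorm_ge0 (x - y); rewrite -/rho le_eqVlt => /predU1P[rho0|rho0].
  rewrite integral0_eq => [|r _].
    by rewrite lee_fin mulr_ge0 ?exprn_ge0// divr_ge0 ?exprn_ge0// -rho0.
  congr EFin; rewrite /k' /k /= -/rho -rho0.
  rewrite ifF ?mul0r//; apply/negP => /and5P[_ _ r0 + _].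
  by rewrite leNgt r0.
pose J := `[(rho / 4)%R, rho]%classic.
have mJ : measurable (J : set (measurableTypeR R)) by exact: measurable_itv.
pose c := (m x y * (4 / rho) ^+ n.+1)%R.
have c0 : (0 <= c)%R by rewrite mulr_ge0// exprn_ge0// divr_ge0// ltW.
apply: (@le_trans _ _ (\int[mu]_r ((cst c%:E) \_ J) r)).
  apply: ge0_le_integral => //.
  - by move=> r _; rewrite lee_fin.
  - apply/measurable_EFinP; exact: (measurable_fun_pair1 y (mk' x)).
  - exact/(measurable_restrictT _ mJ)/measurable_cst.
  - move=> r _; rewrite /k' /k /= -/rho xD yD/=.
    case: ifP => [/and3P[r0 r1 r4]|_]; last first.
      by rewrite mul0r patchE; case: ifP => // _; rewrite lee_fin.
    rewrite patchE mem_set; last first.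
      by rewrite /J/= in_itv/= r1 andbT ler_pdivrMr// mulrC.
    have -> : (m x y / r / r ^+ n = m x y * r^-1 ^+ n.+1)%R.
      by rewrite exprS mulrA exprVn.
    rewrite lee_fin ler_wpM2l// lerXn2r ?nnegrE ?invr_ge0 ?divr_ge0 ?(ltW r0) ?(ltW rho0)//.
    by rewrite ler_pdivlMr// mulrC ler_pdivrMr.
rewrite -integral_mkcond integral_cst//.
rewrite [X in _ * X](_ : _ = (rho - rho / 4)%:E); last first.
  rewrite /J [LHS]lebesgue_measure_itv/= lte_fin ifT//.
  by rewrite ltr_pdivrMr//; lra.
rewrite -EFinM lee_fin /c.
have -> : (4 ^+ n.+1 * (m x y / rho ^+ n) = m x y * (4 / rho) ^+ n.+1 * rho)%R.
  rewrite exprMn exprVn exprS [(rho ^+ n.+1)%R]exprS; field.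
  by rewrite expf_neq0 ?gt_eqF.
by rewrite ler_wpM2l//; lra.
Qed.

(** For fixed x, the substitution y = x + r *: w turns the integral over the
   velocities and the times into the inner integral of the modular. *)
Let inner x : \int[mu]_r \int[lebesgue_rV]_w (q ((w, x), r))%:E <=
  (p ^+ 2 * 4 ^+ n.+1)%:E * \int[lebesgue_rV]_y (modular_density (x, y))%:E.
Proof.
have p20 : (0 <= p ^+ 2)%R by rewrite exprn_ge0// ltW.
have mk'E : measurable_fun [set: measurableTypeR R * E] (fun z => (k' x z)%:E).
  by apply/measurable_EFinP; exact: mk'.
have k'E0 z : 0 <= (k' x z)%:E by rewrite lee_fin.
have mqx : measurable_fun [set: measurableTypeR R * E]
    (fun z => (q ((z.2, x), z.1))%:E).
  apply/measurable_EFinP; apply: (measurableT_comp mq).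
  by apply: measurable_fun_pair => //; exact: measurable_fun_pair.
have qx0 (z : measurableTypeR R * E) : 0 <= (q ((z.2, x), z.1))%:E.
  by rewrite lee_fin.
have kE0 z : 0 <= (k x z)%:E by rewrite lee_fin.
have mkE : measurable_fun [set: measurableTypeR R * E] (fun z => (k x z)%:E).
  by apply/measurable_EFinP; exact: mk.
apply: (@le_trans _ _ (\int[mu]_r ((p ^+ 2)%:E * \int[lebesgue_rV]_y (k' x (r, y))%:E))).
  apply: ge0_le_integral => //.
  - by move=> r _; apply: integral_ge0 => w _; rewrite lee_fin.
  - exact: (measurable_fun_fubini_tonelli_F _ mqx qx0).
  - apply: measurable_funeM; exact: (measurable_fun_fubini_tonelli_F _ mk'E k'E0).
  - move=> r _; have [r0|r0] := leP r 0%R.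
      rewrite integral0_eq; first by rewrite mule_ge0 ?lee_fin//; exact: integral_ge0.
      move=> w _; congr EFin; rewrite /q /=; case: ifP => // _.
      by rewrite [X in [&& _, _ & X]]ltNge r0/= !andbF.
    apply: (@le_trans _ _ (\int[lebesgue_rV]_w
        ((p ^+ 2)%:E * (k x (r, x + r *: w)%R)%:E))).
      apply: ge0_le_integral => //.
      - by move=> w _; rewrite lee_fin.
      - exact: (measurable_fun_pair2 r mqx).
      - apply: measurable_funeM; apply: (measurableT_comp mkE).
        apply: measurable_fun_pair => //.
        exact: measurable_affine_rV.
      - by move=> w _; rewrite -EFinM lee_fin.
    rewrite ge0_integralZl//; last first.
      apply: (measurableT_comp mkE); apply: measurable_fun_pair => //.
      exact: measurable_affine_rV.
    rewrite lee_wpmul2l ?lee_fin//.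
    have mkr := measurable_fun_pair2 r mkE.
    rewrite (@ge0_integral_affine_rV _ _ x r (fun y => (k x (r, y))%:E))//.
    rewrite -ge0_integralZl//; last by rewrite lee_fin invr_ge0 exprn_ge0 ?ltW.
    by rewrite le_eqVlt; apply/orP; left; apply/eqP; apply: eq_integral => y _;
      rewrite -EFinM mulrC.
rewrite ge0_integralZl//; last 2 first.
- exact: (measurable_fun_fubini_tonelli_F _ mk'E k'E0).
- by move=> r _; exact: integral_ge0.
rewrite (EFinM (p ^+ 2)%R) -muleA lee_wpmul2l ?lee_fin//.
rewrite (fubini_tonelli _ mk'E k'E0) -ge0_integralZl//; last first.
  exact: (measurable_fun_pair2 x mME).
apply: ge0_le_integral => //.
- by move=> y _; exact: integral_ge0.
- exact: (measurable_fun_fubini_tonelli_G _ mk'E k'E0).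
- apply: measurable_funeM.
  exact: (measurable_fun_pair2 x mME).
Qed.

Hypothesis muD : lebesgue_rV D < +oo.
Variables (B c c0 : R).
Hypothesis fB : forall x, (`|f x| <= B)%R.
Hypothesis c_gt0 : (0 < c)%R.
Hypothesis fc : forall x, D x -> f x != 0%R -> (c <= delta D x)%R.
Hypothesis c0_gt0 : (0 < c0)%R.
Hypothesis thick : forall x, D x ->
  c0%:E <= lebesgue_rV (annulus `&` [set w | ~ D (x + delta D x *: w)%R]).

Let ray_density_fin w : annulus w ->
  \int[lebesgue_rV]_x (ray_density A s D w f x)%:E < +oo.
Proof.
move=> Ww; have w0 := annulus_neq0 Ww; case/andP: Ww => _ w4.
have B0 : (0 <= B)%R by exact: le_trans (normr_ge0 _) (fB 0%R).
pose K := A (B / (c / 4) `^ s).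
have K0 : (0 <= K)%R by apply: (N_function_ge0 hA); rewrite divr_ge0 ?powR_ge0.
have mK : measurable_fun [set: E] ((cst K%:E) \_ D).
  by apply/(measurable_restrictT _ mD); exact: measurable_cst.
apply: (@le_lt_trans _ _ (\int[lebesgue_rV]_x ((cst K%:E) \_ D) x)); last first.
  by rewrite -integral_mkcond integral_cst// lte_mul_pinfty.
apply: ge0_le_integral => //.
- by move=> x _; rewrite lee_fin ray_density_ge0.
- apply/measurable_EFinP; exact: (measurable_ray_density s hA oD CD0 DM w0 mf).
- move=> x _; rewrite /ray_density patchE; case: ifPn => // /set_mem Dx.
  rewrite lee_fin; apply: (N_function_homo hA); first by rewrite divr_ge0 ?powR_ge0.
  have [->|fx0] := eqVneq (f x) 0%R.
    by rewrite normr0 mul0r divr_ge0 ?powR_ge0.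
  have dx0 := exit_time_gt0 oD CD0 DM w0 Dx.
  have cd : (c / 4 <= exit_time D w x)%R.
    rewrite ler_pdivrMr// (le_trans (fc Dx fx0))//.
    rewrite (le_trans (delta_le_exit_time DM w0 x))// mulrC.
    by rewrite ler_wpM2l// ltW.
  have c40 : (0 < c / 4)%R by rewrite divr_gt0.
  apply: ler_pM => //; first by rewrite invr_ge0 powR_ge0.
  rewrite lef_pV2 ?posrE ?powR_gt0//.
  by rewrite ge0_ler_powR ?nnegrE ?(ltW s0) ?(ltW c40) ?(ltW dx0).
Qed.

(** Integrate the ray inequality over the annulus: c0 bounds from below the
   measure of the velocities for which the exit time is at most the distance to
   the boundary. *)
Lemma directional_hardy :
  c0%:E * \int[lebesgue_rV]_(x in D) (hardy_density x)%:E <=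
  (2 * p / th * (p ^+ 2 * 4 ^+ n.+1))%:E * modular s A D f.
Proof.
case/andP: (th01) => th0 _.
have C10 : (0 <= 2 * p / th)%R by rewrite !mulr_ge0 ?invr_ge0 ?(ltW p0) ?(ltW th0).
have C20 : (0 <= p ^+ 2 * 4 ^+ n.+1)%R.
  by rewrite mulr_ge0 ?exprn_ge0// ltW.
have mgE : measurable_fun [set: E * E] (fun z => (g z)%:E).
  by apply/measurable_EFinP; exact: mg.
have gE0 z : 0 <= (g z)%:E by rewrite lee_fin.
have mqE : measurable_fun [set: (E * E) * measurableTypeR R] (fun z => (q z)%:E).
  by apply/measurable_EFinP; exact: mq.
have qE0 z : 0 <= (q z)%:E by rewrite lee_fin.
pose F (z : E * E) := \int[mu]_r (q (z, r))%:E.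
have mF : measurable_fun [set: E * E] F.
  exact: (measurable_fun_fubini_tonelli_F _ mqE qE0).
have F0 z : 0 <= F z by exact: integral_ge0.
have lower : c0%:E * \int[lebesgue_rV]_(x in D) (hardy_density x)%:E <=
    \int[lebesgue_rV]_w \int[lebesgue_rV]_x (g (w, x))%:E.
  rewrite (fubini_tonelli _ mgE gE0) -ge0_integralZl//; last 3 first.
  - apply/measurable_EFinP/measurable_funTS; exact: measurable_hardy_density.
  - by move=> x _; rewrite lee_fin.
  - by rewrite lee_fin ltW.
  rewrite integral_mkcond; apply: ge0_le_integral => //.
  - move=> x _; rewrite patchE; case: ifP => // _; rewrite -EFinM lee_fin; apply: mulr_ge0 => //; exact: ltW.
  - apply/(measurable_restrictT _ mD); apply: measurable_funeM.
    apply/measurable_EFinP/measurable_funTS; exact: measurable_hardy_density.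
  - exact: (measurable_fun_fubini_tonelli_G _ mgE gE0).
  - move=> x _; rewrite patchE; case: ifPn => [xD|_]; last exact: integral_ge0.
    have Dx := set_mem xD.
    pose Wx := annulus `&` [set w | ~ D (x + delta D x *: w)%R].
    have mWx : measurable Wx.
      apply: measurableI; first exact: measurable_annulus.
      rewrite -[X in measurable X]setTI.
      exact: (measurable_affine_rV x (delta D x) measurableT (measurableC mD)).
    have -> : (fun w => (g (w, x))%:E) = (cst (hardy_density x)%:E) \_ Wx.
      apply/funext => w; rewrite patchE /g /= xD /=.
      have -> : (w \in annulus) && ((x + delta D x *: w)%R \in ~` D) = (w \in Wx).
        apply/andP/idP => [[/set_mem Ww /set_mem Dw]|/set_mem[Ww Dw]].
          by apply: mem_set; split.
        by rewrite !mem_set.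
      by case: ifP.
    rewrite -integral_mkcond integral_cst// muleC.
    by rewrite lee_wpmul2l ?lee_fin//; exact: thick.
apply: (le_trans lower).
have mid : \int[lebesgue_rV]_w \int[lebesgue_rV]_x (g (w, x))%:E <=
    (2 * p / th)%:E * \int[lebesgue_rV]_w \int[lebesgue_rV]_x F (w, x).
  rewrite -ge0_integralZl//; last 2 first.
  - exact: (measurable_fun_fubini_tonelli_F _ mF F0).
  - by move=> w _; exact: integral_ge0.
  apply: ge0_le_integral => //.
  - by move=> w _; exact: integral_ge0.
  - exact: (measurable_fun_fubini_tonelli_F _ mgE gE0).
  - apply: measurable_funeM; exact: (measurable_fun_fubini_tonelli_F _ mF F0).
  - move=> w _; have [Ww|nWw] := pselect (annulus w); last first.
      rewrite integral0_eq; first by rewrite mule_ge0 ?lee_fin//; exact: integral_ge0.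
      by move=> x _; rewrite /g /= memNset.
    have w0 := annulus_neq0 Ww.
    apply: (@le_trans _ _ (\int[lebesgue_rV]_x (ray_density A s D w f x)%:E)).
      apply: ge0_le_integral => //.
      - exact: (measurable_fun_pair2 w mgE).
      - apply/measurable_EFinP; exact: (measurable_ray_density s hA oD CD0 DM w0 mf).
      - by move=> x _; rewrite lee_fin; exact: g_le.
    apply: (le_trans (ray_hardy hA p0 A2 s0 th01 e0 Ath pe oD CD0 DM w0 mf
      (ray_density_fin Ww))).
    rewrite lee_wpmul2l ?lee_fin// le_eqVlt; apply/orP; left; apply/eqP.
    by apply: eq_integral => x _; apply: eq_integral => r _; rewrite qE.
apply: (le_trans mid); rewrite (EFinM (2 * p / th)%R) -muleA lee_wpmul2l ?lee_fin//.
rewrite (fubini_tonelli _ mF F0) modularE -ge0_integralZl//; last 2 first.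
- exact: (measurable_fun_fubini_tonelli_F _ mME ME0).
- by move=> x _; exact: integral_ge0.
apply: ge0_le_integral => //.
- by move=> x _; exact: integral_ge0.
- exact: (measurable_fun_fubini_tonelli_G _ mF F0).
- apply: measurable_funeM; exact: (measurable_fun_fubini_tonelli_F _ mME ME0).
- move=> x _; rewrite /F.
  have mqx : measurable_fun [set: E * measurableTypeR R]
      (fun z => (q ((z.1, x), z.2))%:E).
    apply: (measurableT_comp mqE); apply: measurable_fun_pair => //.
    exact: measurable_fun_pair.
  by rewrite (fubini_tonelli _ mqx (fun z => qE0 _)); exact: inner.
Qed.

End directions.

(** * Exterior balls of Lipschitz domains *)

Section boxes.
Context {R : realType} {n : nat}.
Implicit Types (v x : 'rV[R]_n) (a : R).

Let box v a : set 'rV[R]_n := [set x | forall i, `|x 0 i - v 0 i| < a].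

Lemma lebesgue_rV_cube v a : 0 < a ->
  lebesgue_rV (box v a) = ((2 * a) ^+ n)%:E.
Proof.
move=> a0; pose B i : set (measurableTypeR R) := `]v 0 i - a, v 0 i + a[%classic.
have -> : box v a = [set x | forall i, B i (x ord0 i)].
  by apply/seteqP; split => x /= h i; have := h i;
    rewrite /B /= in_itv/= ltr_distl.
rewrite lebesgue_rV_box => [|i]; last exact: measurable_itv.
rewrite (eq_bigr (fun=> (2 * a)%:E)); last first.
  move=> i _; rewrite [LHS]lebesgue_measure_itv/= lte_fin ifT; last by lra.
  by rewrite -EFinD; congr EFin; lra.
by rewrite prodEFin prodr_const card_ord.
Qed.

Lemma measurable_cube v a : measurable (box v a).
Proof.
pose B i : set (measurableTypeR R) := `]v 0 i - a, v 0 i + a[%classic.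
have -> : box v a = \bigcap_(i in [set: 'I_n]) ((fun x => x ord0 i) @^-1` B i).
  apply/seteqP; split => x /= h i => [_|]; first have := h i.
    by rewrite /B /= in_itv/= ltr_distl.
  by have := h i I; rewrite /B /= in_itv/= ltr_distl.
apply: fin_bigcap_measurable => // i _.
rewrite -[X in measurable X]setTI; apply: measurable_coor => //.
exact: measurable_itv.
Qed.

Lemma open_eball v a : open (eball v a).
Proof.
apply: (@open_comp _ _ (fun x => enorm (x - v)) [set r | r < a]).
  move=> x _; apply: (@lipschitz_continuous _ _ (fun x => enorm (x - v)) 1) => //.
  move=> y z; rewrite mul1r (le_trans (ler_dist_enorm _ _))//.
  by rewrite opprB addrA subrK.
exact: open_lt.
Qed.

(** The ball contains a cube, whose measure is known. *)
Lemma lebesgue_rV_eball_ge v a : 0 < a ->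
  (((2 * (a / n.+1%:R)) ^+ n)%:E <=
  lebesgue_rV (eball v a))%E.
Proof.
move=> a0; have b0 : 0 < a / n.+1%:R by rewrite divr_gt0.
rewrite -(lebesgue_rV_cube v b0); apply: le_measure.
- by rewrite inE; exact: measurable_cube.
- by rewrite inE; apply: open_measurable_rV; exact: open_eball.
- move=> x bx; rewrite /eball/= (le_lt_trans (enorm_le_mx_norm _))//.
  have xa : `|x - v| <= a / n.+1%:R.
    rewrite [leLHS]/Num.norm/= mx_normrE; apply/bigmax_leP.
    split=> [|[i j] _ /=]; first exact: ltW.
    by rewrite ord1 !mxE; exact/ltW/bx.
  rewrite (le_lt_trans (ler_wpM2l _ xa))//.
  by rewrite mulrCA gtr_pMr// ltr_pdivrMr// mul1r ltr_nat.
Qed.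

Lemma lebesgue_rV_bounded (D : set 'rV[R]_n) (M : R) : measurable D ->
  (forall x, D x -> enorm x <= M) -> (lebesgue_rV D < +oo)%E.
Proof.
move=> mD DM; have M0 : 0 < `|M| + 1 by rewrite ltr_wpDl.
apply: (@le_lt_trans _ _ (lebesgue_rV (box 0 (`|M| + 1)))).
  apply: le_measure; rewrite ?inE//; first exact: measurable_cube.
  move=> x Dx i; rewrite mxE subr0 (le_lt_trans (ler_coor_enorm _ _))//.
  by rewrite (le_lt_trans (DM _ Dx))// (le_lt_trans (ler_norm _))// ltrDl.
by rewrite lebesgue_rV_cube// ltry.
Qed.

End boxes.

Section lipschitz_exterior.
Context {R : realType} {n : nat}.
Notation E := 'rV[R]_n.+1.

Lemma linear_isometry_surj (L : {linear E -> E}) : linear_isometry L ->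
  forall u, exists v, L v = u.
Proof.
move=> iL u; pose B := lin1_mx L.
have Bu : B \in unitmx.
  rewrite -row_free_unit; apply: inj_row_free => v.
  rewrite mul_rV_lin1 => Lv0; apply/eqP; rewrite -[_ == _]negbK -enorm_gt0.
  by rewrite -iL Lv0 enorm0 ltxx.
by exists (u *m invmx B); rewrite -mul_rV_lin1 mulmxKV.
Qed.

Lemma linear_isometry_inj (L : {linear E -> E}) : linear_isometry L ->
  injective L.
Proof.
move=> iL x y Lxy; apply/eqP; rewrite -subr_eq0 -[_ == _]negbK -enorm_gt0.
by rewrite -iL linearB Lxy subrr enorm0 ltxx.
Qed.

Lemma enorm_rV_init (x : E) : enorm (rV_init x) <= enorm x.
Proof.
rewrite ler_sqrt; last by apply: sumr_ge0 => i _; exact: sqr_ge0.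
rewrite big_ord_recr/= (eq_bigr (fun i => x 0 (widen_ord (leqnSn n) i) ^+ 2)).
  by rewrite lerDl sqr_ge0.
by move=> i _; rewrite mxE.
Qed.

Lemma enorm_delta_mx (i : 'I_n.+1) : enorm (delta_mx 0 i : E) = 1.
Proof.
rewrite /enorm (bigD1 i)//= big1 => [|j ji].
  by rewrite mxE !eqxx expr1n addr0 sqrtr1.
by rewrite mxE (negPf ji) andbF expr0n.
Qed.

(** Below a boundary point z of the domain, the graph of a Lipschitz function
   leaves a whole cone outside, hence balls of radius comparable with their
   distance to z. In the chart, the centre is taken at distance r straight below
   z, and the ratio 1 / (1 + `|K|) is small enough for the ball to stay in the
   cone of slope `|K|. *)
Lemma exterior_ball_at_boundary (D : set E) (z : E) (r0 K r : R)
    (L : {linear E -> E}) (phi : 'rV[R]_n -> R) :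
  ~ D z -> linear_isometry L -> lipschitz_with K phi ->
  L @` D `&` eball (L z) r0 =
    [set x | phi (rV_init x) < x 0 ord_max] `&` eball (L z) r0 ->
  0 < r -> 2 * r < r0 ->
  exists2 z', enorm (z - z') = r &
    forall y, enorm (y - z') < r / (1 + `|K|) -> ~ D y.
Proof.
move=> Dz iL lphi chart r_gt0 rr0.
have r0_gt0 : 0 < r0 by lra.
have zphi : L z 0 ord_max <= phi (rV_init (L z)).
  rewrite leNgt; apply/negP => lt.
  have : (L @` D `&` eball (L z) r0) (L z).
    by rewrite chart; split => //; rewrite /eball/= subrr enorm0.
  by move=> [[x Dx /(linear_isometry_inj iL) xz] _]; apply: Dz; rewrite -xz.
have [z' Lz'] := linear_isometry_surj iL (L z - r *: delta_mx 0 ord_max).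
have zz' : enorm (z - z') = r.
  rewrite -iL linearB Lz' opprB addrCA subrr addr0 enormZ enorm_delta_mx mulr1.
  by rewrite gtr0_norm.
exists z' => // y yz' Dy.
have K1 : 0 < 1 + `|K| by rewrite ltr_pwDl.
pose u := L y.
have uz' : enorm (u - L z') < r / (1 + `|K|) by rewrite /u -linearB iL.
have rk : r / (1 + `|K|) <= r by rewrite ler_pdivrMr// ler_peMr ?(ltW r_gt0)// lerDl.
have [phiu _] : ([set x | phi (rV_init x) < x 0 ord_max] `&` eball (L z) r0) u.
  rewrite -chart; split; first by exists y.
  rewrite /eball/=; have := ler_enormD (u - L z') (L z' - L z).
  have Lzz' : enorm (L z' - L z) = r by rewrite -linearB iL enormB.
  rewrite addrA subrK Lzz'; lra.
rewrite /= in phiu.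
have du : enorm (rV_init u - rV_init (L z)) < r / (1 + `|K|).
  have -> : rV_init u - rV_init (L z) = rV_init (u - L z').
    apply/rowP => i; rewrite Lz' !mxE.
    rewrite (_ : (widen_ord (leqnSn n) i == ord_max) = false) ?andbF ?mulr0 ?subr0//.
    apply/eqP => /(congr1 val)/= iN.
    by have := ltn_ord i; rewrite iN ltnn.
  exact: le_lt_trans (enorm_rV_init _) uz'.
have uN : u 0 ord_max < L z 0 ord_max - r + r / (1 + `|K|).
  have := ler_coor_enorm (u - L z') ord_max.
  rewrite Lz' !mxE !eqxx mulr1 => h; have := ler_norm (u 0 ord_max - (L z 0 ord_max - r)).
  by rewrite Lz' in uz'; lra.
have lip : phi (rV_init (L z)) - `|K| * (r / (1 + `|K|)) <= phi (rV_init u).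
  have h1 := lphi (rV_init u) (rV_init (L z)).
  have h2 : K * enorm (rV_init u - rV_init (L z)) <= `|K| * (r / (1 + `|K|)).
    apply: (@le_trans _ _ (`|K| * enorm (rV_init u - rV_init (L z)))).
      by rewrite ler_wpM2r ?enorm_ge0// ler_norm.
    by rewrite ler_wpM2l// ltW.
  move: h1; rewrite ler_norml => /andP[h1 _]; lra.
have : `|K| * (r / (1 + `|K|)) + r / (1 + `|K|) = r.
  by field; rewrite gt_eqF.
lra.
Qed.

End lipschitz_exterior.

Section lipschitz_thick.
Context {R : realType} {n : nat}.
Notation E := 'rV[R]_n.+1.
Variable D : set E.

Lemma bounded_enorm : bounded_set D -> exists M : R, forall x, D x -> enorm x <= M.
Proof.
move=> [M0 [_ DM]]; exists (n.+1%:R * (`|M0| + 1)) => x Dx.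
rewrite (le_trans (enorm_le_mx_norm _))// ler_wpM2l//.
by apply: DM => //; rewrite (le_lt_trans (ler_norm _))// ltrDl.
Qed.

Lemma bounded_setC_nonempty (M : R) : (forall x, D x -> enorm x <= M) ->
  ~` D !=set0.
Proof.
move=> DM; exists (const_mx (`|M| + 1)) => /DM; apply/negP; rewrite -ltNge.
rewrite (lt_le_trans _ (ler_coor_enorm _ ord0))// mxE ger0_norm ?addr_ge0//.
by rewrite (le_lt_trans (ler_norm _))// ltrDl.
Qed.

(** Following a ray produces boundary points, which replace nearest points in
   exterior_ball. *)
Lemma boundary_exit_point (M : R) (w x : E) : open D -> ~` D !=set0 ->
  (forall x, D x -> enorm x <= M) -> w != 0 -> D x ->
  boundary D (x + exit_time D w x *: w).
Proof.
move=> oD CD0 DM w0 Dx; set d := exit_time D w x.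
have d0 : 0 < d by exact: (exit_time_gt0 oD CD0 DM w0 Dx).
split; last first.
  by move/interior_subset; exact: (exit_point_notin oD CD0 DM w0).
move=> B /nbhs_eballP[e e0 eB].
have ew : 0 < enorm w by rewrite enorm_gt0.
pose t := Num.min d (e / (2 * enorm w)).
have t0 : 0 < t by rewrite lt_min d0 divr_gt0// mulr_gt0.
have td : t <= d by rewrite ge_min lexx.
have te : t * enorm w < e.
  apply: (@le_lt_trans _ _ (e / 2)); last by lra.
  rewrite -ler_pdivlMr// -mulrA -invfM.
  by rewrite ge_min lexx orbT.
exists (x + (d - t) *: w); split.
  by apply: lt_exit_time; rewrite -/d ?subr_ge0// gtrDl oppr_lt0.
apply: eB; rewrite opprD addrACA subrr add0r -scalerBl subKr.
by rewrite enormZ gtr0_norm.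
Qed.

(** The complement of a Lipschitz domain is thick seen from every interior
   point, at the scale of the distance to the boundary. *)
Lemma exterior_ball (M : R) : lipschitz_domain D ->
  (forall x, D x -> enorm x <= M) ->
  exists2 k : R, 0 < k <= 1 & forall x, D x ->
    exists2 z', enorm (x - z') <= 3 * delta D x &
      forall y, enorm (y - z') < k * delta D x -> ~ D y.
Proof.
move=> [[_ _ oD] _ [r0 [K [r0_gt0 charts]]]] DM.
have CD0 := bounded_setC_nonempty DM; have [y0 Dy0] := CD0.
pose M' := `|M| + enorm y0 + 1.
have M'0 : 0 < M' by rewrite ltr_wpDl// addr_ge0// enorm_ge0.
have deltaM x : D x -> delta D x <= M'.
  move=> Dx; rewrite (le_trans (delta_le x Dy0))//.
  have := ler_enormD x (- y0); rewrite enormN => h.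
  have := DM _ Dx; have := ler_norm M; rewrite /M'; lra.
(* the radius a * delta D x must stay below the radius r0 of the charts *)
pose a := Num.min 1 (r0 / (4 * M')).
have a0 : 0 < a by rewrite lt_min ltr01/= divr_gt0// mulr_gt0.
have a1 : a <= 1 by rewrite ge_min lexx.
have aM' : a * (4 * M') <= r0.
  by rewrite -ler_pdivlMr ?mulr_gt0// ge_min lexx orbT.
have K1 : 0 < 1 + `|K| by rewrite ltr_pwDl.
exists (a / (1 + `|K|)).
  rewrite divr_gt0//= ler_pdivrMr// mul1r (le_trans a1)// lerDl//.
move=> x Dx; have dx0 := delta_gt0 CD0 oD Dx.
(* z is where the segment from x to an almost nearest point y of the
   complement leaves D *)
have [y Dy xy] := delta_adherent CD0 x dx0.
pose w := y - x.
have w0 : w != 0 by rewrite subr_eq0; apply/eqP => yx; apply: Dy; rewrite yx.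
pose z := x + exit_time D w x *: w.
have t1 : exit_time D w x <= 1.
  by apply: exit_time_le => //; rewrite scale1r /w addrC subrK.
have xz : enorm (x - z) <= 2 * delta D x.
  rewrite /z opprD addNKr enormN enormZ ger0_norm ?(exit_time_ge0 DM w0)//.
  rewrite enormB in xy; rewrite (le_trans (_ : _ <= 1 * enorm w))//.
    by rewrite ler_wpM2r// enorm_ge0.
  by rewrite mul1r /w; lra.
have [L [phi [iL lphi chart]]] := charts z (boundary_exit_point oD CD0 DM w0 Dx).
have Dz : ~ D z by exact: (exit_point_notin oD CD0 DM w0).
have ad0 : 0 < a * delta D x by rewrite mulr_gt0.
have ad : 2 * (a * delta D x) < r0.
  have := ler_wpM2l (ltW a0) (deltaM x Dx).
  lra.
have [z' zz' hz'] := exterior_ball_at_boundary Dz iL lphi chart ad0 ad.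
exists z' => [|u uz'].
  have := ler_enormD (x - z) (z - z'); rewrite addrA subrK zz'.
  have : a * delta D x <= 1 * delta D x by rewrite ler_wpM2r// ltW.
  lra.
by apply: hz'; rewrite mulrAC.
Qed.

(** The velocities leading from x into the exterior ball in time delta D x form
   a ball of radius k, by scaling. *)
Lemma exterior_directions (M : R) : lipschitz_domain D ->
  (forall x, D x -> enorm x <= M) ->
  exists2 c : R, 0 < c & forall x, D x ->
    (c%:E <= lebesgue_rV
      (annulus `&` [set w | ~ D (x + delta D x *: w)%R]))%E.
Proof.
move=> lD DM; have [k /andP[k0 k1] hk] := exterior_ball lD DM.
have [[_ _ oD] _ _] := lD; have CD0 := bounded_setC_nonempty DM.
exists ((2 * (k / n.+2%:R)) ^+ n.+1) => [|x Dx].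
  by rewrite exprn_gt0// mulr_gt0// divr_gt0.
have dx0 := delta_gt0 CD0 oD Dx.
have [z xz hz] := hk x Dx.
pose v := (delta D x)^-1 *: (z - x).
apply: (le_trans (lebesgue_rV_eball_ge v k0)).
have scale w : enorm (x + delta D x *: w - z) = delta D x * enorm (w - v).
  rewrite -[X in X * _]gtr0_norm// -enormZ scalerBr /v scalerA divff ?gt_eqF//.
  by rewrite scale1r; congr enorm; apply/rowP => i; rewrite !mxE; ring.
apply: le_measure.
- by rewrite inE; apply: open_measurable_rV; exact: open_eball.
- rewrite inE; apply: measurableI; first exact: measurable_annulus.
  rewrite -[X in measurable X]setTI.
  exact: (measurable_affine_rV x (delta D x) measurableT
    (measurableC (open_measurable_rV oD))).
- move=> w; rewrite /eball/= => wv.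
  have Dw : ~ D (x + delta D x *: w).
    by apply: hz; rewrite scale mulrC ltr_pM2r.
  split => //; rewrite /annulus /=; apply/andP; split.
    have := delta_le x Dw; rewrite opprD addNKr enormN enormZ gtr0_norm//.
    by move=> h; rewrite -(ler_pM2l dx0) mulr1.
  have := ler_enormD (w - v) v; rewrite subrK.
  have : enorm v <= 3.
    rewrite enormZ gtr0_norm ?invr_gt0// enormB mulrC ler_pdivrMr//.
  lra.
Qed.

End lipschitz_thick.

(** * Test functions and the two constants *)

Section test_functions.
Context {R : realType} {n : nat}.
Notation E := 'rV[R]_n.
Variables (D : set E) (f : E -> R).
Hypothesis fD : Cc_smooth D f.
Hypothesis f0 : f <> cst 0.

Lemma test_continuous : continuous f.
Proof. by case: fD => /(_ 0%N). Qed.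

Lemma test_neq0 : exists x, f x != 0.
Proof.
apply: contrapT => h; apply: f0; apply/funext => x /=.
by apply: contrapT => /eqP fx; apply: h; exists x.
Qed.

Lemma test_support x : f x != 0 -> D x.
Proof. by case: fD => _ [_ +] fx; apply; exact: subset_closure. Qed.

Lemma test_bounded : exists B, forall x, `|f x| <= B.
Proof.
have [x0 fx0] := test_neq0; case: fD => _ [cK _].
have cf : {within closure [set x | f x != 0], continuous (fun x => `|f x|)}.
  apply: continuous_subspaceT => x; apply: continuous_comp.
    exact: test_continuous.
  exact: norm_continuous.
have K0 : closure [set x | f x != 0] !=set0.
  by exists x0; exact: subset_closure.
have [y _ hy] := EVT_max_rV K0 cK cf.
exists `|f y| => x; have [->|fx] := eqVneq (f x) 0; first by rewrite normr0.
by apply: hy; apply/mem_set/subset_closure.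
Qed.

Lemma test_delta : open D -> ~` D !=set0 ->
  exists2 c, 0 < c & forall x, f x != 0 -> c <= delta D x.
Proof.
move=> oD CD0; have [x0 fx0] := test_neq0; case: fD => _ [cK KD].
have cf : {within closure [set x | f x != 0], continuous (delta D)}.
  by apply: continuous_subspaceT; exact: (delta_continuous CD0).
have K0 : closure [set x | f x != 0] !=set0.
  by exists x0; exact: subset_closure.
have [y yK hy] := EVT_min_rV K0 cK cf.
exists (delta D y); first by apply: (delta_gt0 CD0 oD); apply: KD; exact: set_mem.
by move=> x fx; apply: hy; apply/mem_set/subset_closure.
Qed.

End test_functions.

(** Finiteness and positivity of the denominators are needed, as quotients by 0
   or +oo carry no information in the extended reals. *)
Lemma lt0_ereal_inf_quotient {R : realType} (T : Type) (S : set T)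
    (N I : T -> \bar R) (k : R) : 0 < k ->
  (forall t, S t -> 0 < I t /\ I t < +oo /\ k%:E * I t <= N t)%E ->
  (0 < ereal_inf [set N t / I t | t in S])%E.
Proof.
move=> k0 h; apply: (@lt_le_trans _ _ k%:E); first by rewrite lte_fin.
apply: le_ereal_inf_tmp => _ [t /h[It0 [Itoo kN]] <-].
have fI : I t \is a fin_num by rewrite ge0_fin_numE// ltW.
move: It0 kN; rewrite -(fineK fI) lte_fin => It0 kN.
by rewrite inver gt_eqF// lee_pdivlMr.
Qed.

Theorem theorem1p2 (R : realType) (n : nat) (D : set 'rV[R]_n.+1) (A : R -> R)
    (s : R) (hD : lipschitz_domain D) (hA : N_function A) (hA2 : Delta2 A)
    (hs0 : 0 < s) (hs1 : s < 1)
    (halpha : limf_einf (alpha s A) (0^'+) = 0%E) :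
  FOHI s A D /\ RFOPI s A D.
Proof.
have [[_ _ oD] bD _] := hD.
have [M DM] := bounded_enorm bD.
have CD0 := bounded_setC_nonempty DM; have [y0 Dy0] := CD0.
have [p p0 A2] := hA2.
(* 1 / (2 * p) is the value of e for which the proportion p * e absorbed in
   ray_hardy is one half *)
have e0 : 0 < (2 * p)^-1 by rewrite invr_gt0 mulr_gt0.
have [l /andP[l0 l1] Al] := limf_einf_alpha0 hA hs0 p0 A2 halpha e0.
pose th := l `^ s^-1.
have th01 : 0 < th < 1.
  have one : (1 : R) `^ s^-1 = 1 by rewrite powR1.
  rewrite powR_gt0//= -[ltRHS]one.
  by rewrite gt0_ltr_powR ?invr_gt0 ?nnegrE// ltW.
have ths : th `^ s = l by rewrite -powRrM mulVf ?gt_eqF// powRr1// ltW.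
have Ath t : 0 <= t -> A (th `^ s * t) <= (2 * p)^-1 * th * A t.
  by rewrite ths; exact: Al.
have pe : p * (2 * p)^-1 <= 2^-1 by rewrite invfM mulrCA divff ?gt_eqF// mulr1.
have [c0 c00 thick] := exterior_directions hD DM.
have mD : measurable D by exact: open_measurable_rV.
have s01 : 0 < s < 1 by rewrite hs0.
pose C := 2 * p / th * (p ^+ 2 * 4 ^+ n.+2).
have C0 : 0 < C.
  case/andP: th01 => t0 _.
  apply: mulr_gt0; first by rewrite divr_gt0// mulr_gt0.
  by apply: mulr_gt0; exact: exprn_gt0.
have [k Mk] : exists k : nat, forall x, D x -> delta D x `^ s <= 2 ^+ k.
  pose M' := `|M| + enorm y0 + 1.
  exists (Num.truncn (M' `^ s)).+1 => x Dx.
  have xM : delta D x <= M'.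
    rewrite (le_trans (delta_le x Dy0))//.
    have := ler_enormD x (- y0); rewrite enormN => h.
    have := DM _ Dx; have := ler_norm M; rewrite /M'; lra.
  have dx0 := delta_gt0 CD0 oD Dx.
  apply: (@le_trans _ _ (M' `^ s)).
    by rewrite ge0_ler_powR ?nnegrE ?(ltW hs0) ?(ltW dx0) ?(le_trans (ltW dx0) xM).
  rewrite (le_trans (ltW (truncnS_gt _)))// -natrX ler_nat.
  exact/ltnW/ltn_expl.
have mA (f : 'rV[R]_n.+1 -> R) : Cc_smooth D f ->
    measurable_fun D (fun x => (A `|f x|)%:E).
  move=> fD; apply/measurable_EFinP/measurable_funTS.
  apply: (measurable_N_function hA) => [//|].
  apply: (measurableT_comp (f := @Num.norm _ R)) => //.
  by apply: continuous_measurable_rV; exact: (test_continuous fD).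
have A0 t : 0 <= t -> 0 <= A t by exact: (N_function_ge0 hA).
(* the Poincare denominator is controlled by the Hardy one, as delta is
   bounded on D and A is doubling *)
have compare f : Cc_smooth D f ->
    (\int[lebesgue_rV]_(x in D) (A `|f x|)%:E <= (p ^+ k)%:E *
      \int[lebesgue_rV]_(x in D) (A (`|f x| / delta D x `^ s))%:E)%E.
  move=> fD.
  have mf := continuous_measurable_rV (test_continuous fD).
  have mh := measurable_funTS (D := D) (measurable_hardy_density s hA CD0 mf).
  have mhE : measurable_fun D (fun x => (A (`|f x| / delta D x `^ s))%:E).
    exact/measurable_EFinP.
  rewrite -ge0_integralZl//; last 2 first.
  - by move=> x _; rewrite lee_fin A0// divr_ge0 ?powR_ge0.
  - by rewrite lee_fin exprn_ge0// ltW.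
  apply: ge0_le_integral; first exact: mD.
  - by move=> x _; rewrite lee_fin A0.
  - exact: mA.
  - exact: measurable_funeM.
  - move=> x Dx; rewrite -EFinM lee_fin.
    have dx0 : 0 < delta D x `^ s by rewrite powR_gt0// (delta_gt0 CD0).
    apply: (le_trans _ (Delta2_pow hA A2 _ p0 _)); last first.
      by rewrite divr_ge0 ?powR_ge0.
    apply: (N_function_homo hA); first exact: normr_ge0.
    rewrite mulrCA ler_peMr// ler_pdivlMr// mul1r; exact: Mk.
(* |f| exceeds half of a nonzero value on a ball *)
have positive f : Cc_smooth D f -> f <> cst 0 ->
    (0 < \int[lebesgue_rV]_(x in D) (A `|f x|)%:E)%E.
  move=> fD f0; have [x0 fx0] := test_neq0 f0.
  pose b := `|f x0| / 2; have b0 : 0 < b by rewrite divr_gt0// normr_gt0.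
  have [r r0 hr] : exists2 r, 0 < r & forall y, enorm (x0 - y) < r -> b < `|f y|.
    apply/nbhs_eballP; apply: open_nbhs_nbhs; split; last first.
      by rewrite /= /b ltr_pdivrMr// mulr_natr mulr2n ltrDl normr_gt0.
    apply: (@open_comp _ _ (fun y => `|f y|) [set t | b < t]); last exact: open_gt.
    move=> y _; apply: continuous_comp; first exact: (test_continuous fD).
    exact: norm_continuous.
  have rD : eball x0 r `<=` D.
    move=> y; rewrite /eball/= enormB => /hr bf; apply: (test_support fD).
    by rewrite -normr_gt0 (lt_trans b0).
  have mB : measurable (eball x0 r) by apply: open_measurable_rV; exact: open_eball.
  apply: (@lt_le_trans _ _ ((A b)%:E * lebesgue_rV (eball x0 r))%E).
    apply: mule_gt0; first by rewrite lte_fin (N_function_gt0 hA A2 p0).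
    apply: (lt_le_trans _ (lebesgue_rV_eball_ge _ r0)).
    by rewrite lte_fin exprn_gt0// mulr_gt0// divr_gt0.
  rewrite -integral_cst//.
  apply: (@le_trans _ _ (\int[lebesgue_rV]_(x in eball x0 r) (A `|f x|)%:E)%E).
    apply: ge0_le_integral; first exact: mB.
    - by move=> y _; rewrite lee_fin A0// ltW.
    - exact: measurable_cst.
    - exact: measurable_funS (mA _ fD).
    - move=> y; rewrite /eball/= enormB => /hr bf; rewrite lee_fin.
      by apply: (N_function_homo hA); exact: ltW.
  by apply: ge0_subset_integral => //; [exact: mA|move=> y _; rewrite lee_fin A0].
have hardy f : Cc_smooth D f -> f <> cst 0 ->
    ((c0 / C)%:E * \int[lebesgue_rV]_(x in D) (A (`|f x| / delta D x `^ s))%:E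
      <= modular s A D f)%E.
  move=> fD f0.
  have [B fB] := test_bounded fD f0.
  have [c c_gt0 fc] := test_delta fD f0 oD CD0.
  have mf := continuous_measurable_rV (test_continuous fD).
  have := directional_hardy hA p0 A2 s01 th01 (ltW e0) Ath pe oD CD0 DM mf
    (lebesgue_rV_bounded mD DM) fB c_gt0 (fun x _ => fc x) c00 thick.
  rewrite /hardy_density -/C => h.
  have C1 : (0 <= (C^-1)%:E)%E by rewrite lee_fin invr_ge0 ltW.
  have := lee_wpmul2l C1 h.
  by rewrite !muleA -!EFinM mulVf ?gt_eqF// mul1e mulrC.
have finite f : Cc_smooth D f -> f <> cst 0 ->
    (\int[lebesgue_rV]_(x in D) (A (`|f x| / delta D x `^ s))%:E < +oo)%E.
  move=> fD f0.
  have [B fB] := test_bounded fD f0.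
  have B0 : 0 <= B by exact: le_trans (normr_ge0 _) (fB 0).
  have [c c_gt0 fc] := test_delta fD f0 oD CD0.
  have mf := continuous_measurable_rV (test_continuous fD).
  have mh := measurable_funTS (D := D) (measurable_hardy_density s hA CD0 mf).
  pose K := A (B / c `^ s).
  have K0 : 0 <= K by rewrite A0// divr_ge0 ?powR_ge0.
  apply: (@le_lt_trans _ _ (\int[lebesgue_rV]_(x in D) (cst K%:E) x)%E); last first.
    by rewrite integral_cst// lte_mul_pinfty//; exact: lebesgue_rV_bounded DM.
  apply: ge0_le_integral; first exact: mD.
  - by move=> x _; rewrite lee_fin A0// divr_ge0 ?powR_ge0.
  - exact/measurable_EFinP.
  - exact: measurable_cst.
  - move=> x Dx; rewrite lee_fin.
    apply: (N_function_homo hA); first by rewrite divr_ge0 ?powR_ge0.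
    have [->|fx] := eqVneq (f x) 0.
      by rewrite normr0 mul0r divr_ge0 ?powR_ge0.
    have dx0 := delta_gt0 CD0 oD Dx.
    apply: ler_pM => //; first by rewrite invr_ge0 powR_ge0.
    rewrite lef_pV2 ?posrE ?powR_gt0//.
    by rewrite ge0_ler_powR ?nnegrE ?(ltW hs0) ?(ltW c_gt0) ?(ltW dx0) ?fc.
have pk0 : 0 < p ^+ k by rewrite exprn_gt0.
split.
  apply: (@lt0_ereal_inf_quotient _ _ _ _ _ (c0 / C)); first exact: divr_gt0.
  move=> f [fD f0]; split; last by split; [exact: finite|exact: hardy].
  have := lt_le_trans (positive f fD f0) (compare f fD).
  by rewrite pmule_rgt0// lte_fin.
apply: (@lt0_ereal_inf_quotient _ _ _ _ _ (c0 / C / p ^+ k)).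
  by rewrite !divr_gt0.
move=> f [fD f0]; split; [exact: positive|split].
  apply: (le_lt_trans (compare f fD)); rewrite lte_mul_pinfty ?lee_fin ?(ltW pk0)//.
  exact: finite.
apply: (le_trans _ (hardy f fD f0)).
rewrite (EFinM (c0 / C)) -muleA; apply: lee_wpmul2l.
  by rewrite lee_fin ltW// divr_gt0.
have pk1 : (0 <= ((p ^+ k)^-1)%:E)%E by rewrite lee_fin invr_ge0 ltW.
have := lee_wpmul2l pk1 (compare f fD).
by rewrite muleA -EFinM mulVf ?gt_eqF// mul1e.
Qed.
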